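(* Let $k\ge 1$ and let $$\pi:\ X_k \xrightarrow{\pi^k} X_{k-1} \xrightarrow{\pi^{k-1}} \cdots \xrightarrow{\pi^2} X_1 \xrightarrow{\pi^1} X_0$$ be a composition of proper maps of algebraic varieties, $\pi=\pi^1\circ\cdots\circ\pi^k$. For each $i\in\{1,\dots,k\}$ let $c_i\in A^*(X_i)$ be an arbitrarily chosen class. Assume that for each $i\in\{1,\dots,k\}$ there are a finite set $M_i\subset\mathbb{Z}^{i-1}$ of integer vectors $m_i=(m_i^1,\dots,m_i^{i-1})$ and, for each $m_i\in M_i$, a formal Laurent series $Q_{m_i}(u)\in A^*(X_0)((u^{-1}))$ such that $$\pi^i_*\left(\frac{1}{u-c_i}\right)=\prod_{m_i\in M_i} Q_{m_i}\big(u+m_i^{i-1}c_{i-1}+\cdots+m_i^1c_1\big),$$ as series in $u^{-1}$ with coefficients in $A^*(X_{i-1})$, where the right-hand side is expanded in non-negative powers of $c_1,\dots,c_{i-1}$. Let $u_1,\dots,u_k$ be formal variables and, for each $i\in\{1,\dots,k\}$, let $A_i$ be a finite set of further formal variables (all the variables $u_1,\dots,u_k$ and all elements of $A_1,\dots,A_k$ being distinct and independent). Then $$\pi_*\prod_{i=1}^k\left(\frac{1}{u_i-c_i}\prod_{u\in A_i}\frac{1}{u-c_i}\right)=\left[\prod_{i=1}^k\left(\prod_{m_i\in M_i}Q_{m_i}\big(u_i+m_i^{i-1}u_{i-1}+\cdots+m_i^1u_1\big)\prod_{u\in A_i}\frac{1}{u-u_i}\right)\right]_-,$$ where on the right-hand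 side each $Q_{m_i}(u_i+m_i^{i-1}u_{i-1}+\cdots+m_i^1u_1)$ is expanded in non-negative powers of $u_{i-1},\dots,u_1$, each $(u-u_i)^{-1}$ with $u\in A_i$ is expanded in non-negative powers of $u_i$, and $[\dots]_-$ means that only those monomials are kept in which all the variables $u_1,\dots,u_k$ and all the variables $u\in A_1\cup\cdots\cup A_k$ have negative exponents.
   Context: $A^*(X)$ denotes the Chow ring of $X$, a commutative ring. The $X_i$ are such that these rings come with pull-backs (ring homomorphisms) and with proper push-forwards $f_*:A^*(X')\to A^*(X)$ that are functorial and satisfy the projection formula $f_*(f^*a\cdot b)=a\cdot f_*b$ (for example, all $X_i$ smooth). Pull-back maps along the tower are suppressed from the notation: classes $c_j\in A^*(X_j)$ and classes in $A^*(X_0)$ are regarded as classes on any $X_i$ higher in the tower by pull-back. For a formal variable $u$ and a class $c$, $\frac1{u-c}$ denotes the series $\sum_{n\ge0}c^n u^{-n-1}$ in $u^{-1}$; push-forwards are applied to such series coefficient by coefficient. For a Laurent series $Q(u)=\sum_{\alpha\le N}q_\alpha u^\alpha$ and elements $x_1,\dots,x_r$ (classes or variables), $Q(u+x_1+\cdots+x_r)$ expanded in non-negative powers of the $x$'s means $\sum_\alpha q_\alpha\sum_{n\ge0}\binom{\alpha}{n}u^{\alpha-n}(x_1+\cdots+x_r)^n$. For $i=1$ the vectors $m_1$ are empty, so the hypothesis reads $\pi^1_*\left(\frac1{u-c_1}\right)=\prod_{m_1}Q_{m_1}(u)$. *)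

(* Defs.v *)
From HB Require Import structures.
From mathcomp Require Import all_boot all_order all_algebra finmap.
From mathcomp Require Import all_classical.

Set Implicit Arguments.
Unset Strict Implicit.
Unset Printing Implicit Defensive.

Import Order.TTheory GRing.Theory Num.Theory.
Local Open Scope ring_scope.

(** * Chow rings *)

(** Varieties, proper maps and their Chow rings are axiomatized by their formal
    properties: functorial pull-backs (ring morphisms), functorial push-forwards
    along proper maps, and the projection formula.  The Chow ring of the empty
    variety is zero, hence [comPzRingType].  The value of [push f] is
    irrelevant (it may be 0) when [f] is not proper. *)
Record chow_theory := ChowTheory {
  variety : Type;
  mor : variety -> variety -> Type;
  idm : forall X, mor X X;
  compm : forall X Y Z, mor Y Z -> mor X Y -> mor X Z;
  compmA : forall W X Y Z (h : mor Y Z) (g : mor X Y) (f : mor W X),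
    compm h (compm g f) = compm (compm h g) f;
  comp1m : forall X Y (f : mor X Y), compm (idm Y) f = f;
  compm1 : forall X Y (f : mor X Y), compm f (idm X) = f;
  proper_map : forall X Y, mor X Y -> Prop;
  proper_id : forall X, proper_map (idm X);
  proper_comp : forall X Y Z (g : mor Y Z) (f : mor X Y),
    proper_map g -> proper_map f -> proper_map (compm g f);
  chow : variety -> comPzRingType;
  pull : forall X Y, mor X Y -> {rmorphism chow Y -> chow X};
  pull_id : forall X (a : chow X), pull (idm X) a = a;
  pull_comp : forall X Y Z (g : mor Y Z) (f : mor X Y) (a : chow Z),
    pull (compm g f) a = pull f (pull g a);
  push : forall X Y, mor X Y -> {additive chow X -> chow Y};
  push_id : forall X (a : chow X), push (idm X) a = a;
  push_comp : forall X Y Z (g : mor Y Z) (f : mor X Y) (a : chow X),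
    proper_map g -> proper_map f -> push (compm g f) a = push g (push f a);
  projection_formula : forall X Y (f : mor X Y) (a : chow Y) (b : chow X),
    proper_map f -> push f (pull f a * b) = a * push f b
}.

Arguments idm {_} _.
Arguments compm {_ _ _ _} _ _.
Arguments proper_map {_ _ _} _.
Arguments pull {_ _ _} _.
Arguments push {_ _ _} _.

(** [p i : X_{i+1} -> X_i]; [tower_map p n : X_n -> X_0] is the composite
    [p 0 \o ... \o p (n - 1)].  A finite tower can be prolonged by identities. *)
Fixpoint tower_map (C : chow_theory) (X : nat -> variety C)
    (p : forall i, mor (X i.+1) (X i)) (n : nat) : mor (X n) (X 0%N) :=
  match n with
  | 0 => idm (X 0%N)
  | n'.+1 => compm (tower_map p n') (p n')
  end.

(** [c j] lives on [X_{j+1}]; for [j < n], [tower_class p c n j] is its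
    pull-back to [X_n] along the tower (and it is 0, a dummy value, when
    [n <= j]). *)
Fixpoint tower_class (C : chow_theory) (X : nat -> variety C)
    (p : forall i, mor (X i.+1) (X i)) (c : forall i, chow (X i.+1))
    (n : nat) : nat -> chow (X n) :=
  match n with
  | 0 => fun _ => 0
  | n'.+1 => fun j =>
      if j == n' then c n' else pull (p n') (tower_class p c n' j)
  end.

(** * Formal series *)

(** Exponents of the monomials in the variables [V], which may be negative. *)
Notation expo V := {ffun V -> int}.

(** Formal, possibly infinite, sums of Laurent monomials: [s e] is the
    coefficient of the monomial with exponent vector [e]. *)
Definition fseries (V : finType) (R : Type) := expo V -> R.

(** For an integer [a], the product is divisible by [n`!]: [%/] is exact. *)
Definition binz (a : int) (n : nat) : int :=
  ((\prod_(j < n) (a - j%:Z)) %/ (n`!)%:Z)%Z.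

Section Series.
Variables (V : finType) (R : comPzRingType).
Implicit Types (s t x : fseries V R) (u : V).

Definition sconst (a : R) : fseries V R := fun e => if e == 0 then a else 0.

(** The monomial [u ^ a], for an integer [a]. *)
Definition svarX u (a : int) : fseries V R :=
  fun e => (e == [ffun w => if w == u then a else 0])%:R.

Definition svar u : fseries V R := svarX u 1.

Definition sone : fseries V R := sconst 1.

(** The sum over [d] is a finite-support sum ([\sum_(_ \in _)] is by definition
    0 if infinitely many terms are nonzero).  The support is finite whenever
    the supports of [s] and [t] are well-ordered for the reverse of one
    lexicographic order on the exponents. *)
Definition smul s t : fseries V R :=
  fun e => \sum_(d \in [set: expo V]%classic) s d * t (e - d).

Definition sexp x (n : nat) : fseries V R := iter n (smul x) sone.

(** [1 / (u - x)], expanded in non-negative powers of [x]: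
    the sum of the [x ^ n u ^ (- n - 1)]. *)
Definition sgeom u x : fseries V R :=
  fun e => \sum_(n \in [set: nat]%classic)
    smul (sexp x n) (svarX u (- n%:Z - 1)) e.

(** [q (u + x)], for [q] the Laurent series with coefficients [q a], expanded
    in non-negative powers of [x]. *)
Definition sshift (q : int -> R) u x : fseries V R :=
  fun e => \sum_(a \in [set: int]%classic)
    q a * (\sum_(n \in [set: nat]%classic)
             smul (svarX u (a - n%:Z)) (sexp x n) e *~ binz a n).

(** The part in which all the variables have negative exponents. *)
Definition sneg s : fseries V R :=
  fun e => if [forall w, e w < 0] then s e else 0.

End Series.

Arguments sconst {V R} _.
Arguments svarX {V R} _ _.
Arguments svar {V R} _.
Arguments sone {V R}.

(** A Laurent series in [u^-1]: the exponents of [u] are bounded above. *)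
Definition laurent (R : nmodType) (q : int -> R) : Prop :=
  exists N : int, forall a : int, N < a -> q a = 0.

Definition spush (C : chow_theory) (X Y : variety C) (f : mor X Y)
    (V : finType) (s : fseries V (chow X)) : fseries V (chow Y) :=
  fun e => push f (s e).

(** The variables of the theorem: [u_i] for [i < k], and the elements of the
    pairwise disjoint sets [A_i]. *)
Notation vars k A := ('I_k + {i : 'I_k & A i})%type.

Definition uvar (k : nat) (A : 'I_k -> finType) (i : 'I_k) : vars k A := inl i.

Definition avar (k : nat) (A : 'I_k -> finType) (i : 'I_k) (a : A i) :
  vars k A := inr (Tagged (fun i => A i) a).

Notation "\sprod_ ( i <- r ) F" := (\big[@smul _ _/sone]_(i <- r) F)
  (at level 36, F at level 36, i, r at level 50,
   format "'[' \sprod_ ( i  <-  r ) '/  '  F ']'") : ring_scope.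
Notation "\sprod_ ( i < n ) F" := (\big[@smul _ _/sone]_(i < n) F)
  (at level 36, F at level 36, i, n at level 50,
   format "'[' \sprod_ ( i  <  n ) '/  '  F ']'") : ring_scope.
Notation "\sprod_ ( i : t ) F" := (\big[@smul _ _/sone]_(i : t) F)
  (at level 36, F at level 36, i at level 50,
   format "'[' \sprod_ ( i   :  t ) '/  '  F ']'") : ring_scope.

(* Main.v *)
Require Import Defs.
From mathcomp Require Import all_boot all_order all_algebra finmap.
From mathcomp Require Import all_classical.
From mathcomp Require Import zify ring.

Import Order.TTheory GRing.Theory Num.Theory.
Local Open Scope ring_scope.

Set Implicit Arguments.
Unset Strict Implicit.
Unset Printing Implicit Defensive.

(** Both sides vanish at exponents that are not all negative. At an exponent [e]
    with all coordinates negative, the left-hand side is the push-forward of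
    [\prod_i c_i ^ N_i], where [N_i] is the sum of the [- e v - 1] over
    the variables [v] among [u_i] and [A_i]. Let [F_i] be the [i]-th factor on
    the right, [S_j] the product of the [F_i] with [i >= j], and [T_j] the
    substitution of [c_l] for [u_l], [l < j]. By the projection formula and
    the hypothesis on [p_j], multiplying [T_j S_(j+1)] by [T_j F_j] and
    extracting the coefficient of the variables of the [j]-th block amounts to
    pushing [c_j ^ N_j * T_(j+1) S_(j+1)] forward along [p_j]; iterating this
    relates [S_0] to the empty product [S_k].

    The substitutions commute with products because all the series involved
    have, for each variable [v], bounded sums of the exponents of [v] and of the
    variables of higher rank, the ranks being
    [u_0 < u_1 < ... < the elements of the A_i]. *)

(** * Finite-support sums over a whole type *)

Local Notation "\fsum_ ( i : T ) F" := (\sum_(i \in [set: T]%classic) F)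
  (at level 41, F at level 41, i, T at level 50).

Section FiniteSums.
Variables (R : nmodType) (I : choiceType).

(** A sum of infinite support has the dummy value 0, so exchanging or distributing sums requires a
    finite set that contains the support; over such a set the sum is an ordinary one. *)
Lemma fsumE (A : {fset I}) (F : I -> R) :
  (forall i, F i != 0 -> i \in A) -> \fsum_(i : I) F i = \sum_(i <- A) F i.
Proof.
by move=> FA; apply: fsbigTE => i; apply: contraNeq => /FA.
Qed.

Lemma fsum1 (i0 : I) (F : I -> R) :
  (forall i, i != i0 -> F i = 0) -> \fsum_(i : I) F i = F i0.
Proof.
move=> Fi0; rewrite (@fsumE [fset i0]%fset) ?big_seq_fset1 // => i.
by rewrite inE; apply: contraR => /Fi0 ->.
Qed.

Lemma fsum_eq0 (F : I -> R) : (forall i, F i = 0) -> \fsum_(i : I) F i = 0.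
Proof. by move=> F0; apply: fsbig1. Qed.

Lemma eq_fsum (F G : I -> R) : F =1 G -> \fsum_(i : I) F i = \fsum_(i : I) G i.
Proof. by move=> FG; apply: eq_fsbigr => i _. Qed.

End FiniteSums.

Section FiniteSumsExchange.
Variables (R : nmodType) (I J : choiceType).

(** Confining the joint support to a finite rectangle turns both sides into ordinary double sums.
    Finiteness of the inner sums would not be enough: an outer sum could still have infinite
    support. *)
Lemma fsum_exchange (A : {fset I}) (B : {fset J}) (F : I -> J -> R) :
  (forall i j, F i j != 0 -> i \in A) -> (forall i j, F i j != 0 -> j \in B) ->
  \fsum_(i : I) \fsum_(j : J) F i j = \fsum_(j : J) \fsum_(i : I) F i j.
Proof.
move=> FA FB.
have EL i : \fsum_(j : J) F i j = \sum_(j <- B) F i j by apply: fsumE => j /FB.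
have ER j : \fsum_(i : I) F i j = \sum_(i <- A) F i j by apply: fsumE => i /FA.
rewrite (eq_fsum EL) (eq_fsum ER) (@fsumE _ _ A); last first.
  move=> i; apply: contraNT => iA; rewrite big1 // => j _.
  by apply: contraNeq iA => /FA.
rewrite exchange_big; apply/esym/fsbigTE => j jB; apply: big1 => i _.
by apply: contraNeq jB => /FB.
Qed.

Lemma fsum_inj (f : I -> J) (F : J -> R) : injective f ->
  (forall j, F j != 0 -> exists i, j = f i) ->
  \fsum_(j : J) F j = \fsum_(i : I) F (f i).
Proof.
move=> f_inj Ff.
rewrite -(@fsbig_image _ _ _ _ _ [set: I]%classic f) => [|x y _ _ /f_inj //].
apply/esym/fsbig_widen => // j [_ /=] nj.
apply: contra_notP nj => /eqP /Ff [i ->].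
by exists i.
Qed.

End FiniteSumsExchange.

Section FiniteSumsMorphism.
Variables (R R' : nmodType) (I : choiceType) (h : {additive R -> R'}).

Lemma raddf_fsum (A : {fset I}) (F : I -> R) :
  (forall i, F i != 0 -> i \in A) ->
  h (\fsum_(i : I) F i) = \fsum_(i : I) h (F i).
Proof.
move=> FA; rewrite (fsumE FA) raddf_sum (@fsumE _ _ A) // => i.
apply: contraR => iA; rewrite (_ : F i = 0) ?raddf0 //.
by apply: contraNeq iA => /FA.
Qed.

End FiniteSumsMorphism.

Section FiniteSumsRing.
Variables (R : pzRingType) (I : choiceType).

Lemma mulr_fsum_r (A : {fset I}) (F : I -> R) (a : R) :
  (forall i, F i != 0 -> i \in A) ->
  a * (\fsum_(i : I) F i) = \fsum_(i : I) a * F i.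
Proof.
move=> FA; rewrite (fsumE FA) mulr_sumr (@fsumE _ _ A) // => i aFi.
by apply: FA; apply: contraNneq aFi => ->; rewrite mulr0.
Qed.

Lemma mulr_fsum_l (A : {fset I}) (F : I -> R) (a : R) :
  (forall i, F i != 0 -> i \in A) ->
  (\fsum_(i : I) F i) * a = \fsum_(i : I) F i * a.
Proof.
move=> FA; rewrite (fsumE FA) mulr_suml (@fsumE _ _ A) // => i Fia.
by apply: FA; apply: contraNneq Fia => ->; rewrite mul0r.
Qed.

End FiniteSumsRing.

Lemma if_neq0 (R : nmodType) (b : bool) (z : R) :
  (if b then z else 0) != 0 -> b /\ z != 0.
Proof. by case: b; rewrite ?eqxx. Qed.

Lemma mulr_neq0W (R : pzRingType) (z z' : R) :
  z * z' != 0 -> z != 0 /\ z' != 0.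
Proof.
by move=> zz'; split; apply: contraNneq zz' => ->; rewrite (mul0r, mulr0).
Qed.

(** * Exponent vectors and their upper sums *)

Section Exponents.
Variable V : finType.
Implicit Types (e d : expo V) (u v w : V).

(** The exponent of [u ^ a]. *)
Definition eX u (a : int) : expo V := [ffun w => if w == u then a else 0].

Lemma eXE u a w : eX u a w = if w == u then a else 0.
Proof. by rewrite ffunE. Qed.

Variable rk : V -> nat.

(** Replacing a factor by a variable of lower rank never increases an upper sum, and the expansions
    of the theorem do just that. Other variables of the same rank as [v] are left out, so that all
    elements of the [A_i] may share one rank. *)
Definition usum v e : int := e v + \sum_(w | (rk v < rk w)%N) e w.

Lemma usumD v e d : usum v (e + d) = usum v e + usum v d.
Proof.
rewrite /usum ffunE.
rewrite (eq_bigr (fun w => e w + d w)) => [|w _]; last by rewrite ffunE.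
by rewrite big_split /=; ring.
Qed.

Lemma usum0 v : usum v 0 = 0.
Proof. by rewrite /usum ffunE add0r big1 // => w _; rewrite ffunE. Qed.

Lemma usumN v e : usum v (- e) = - usum v e.
Proof. by apply/eqP; rewrite -addr_eq0 -usumD addNr usum0. Qed.

Lemma usumB v e d : usum v (e - d) = usum v e - usum v d.
Proof. by rewrite usumD usumN. Qed.

Lemma usum_eX v u a :
  usum v (eX u a) = if (v == u) || (rk v < rk u)%N then a else 0.
Proof.
rewrite /usum eXE; under eq_bigr do rewrite eXE.
rewrite -big_mkcondr /=; case: ifP => [/eqP -> /=|vu /=].
  by rewrite big1 ?addr0 // => w /andP[uw /eqP wu]; rewrite wu ltnn in uw.
rewrite add0r; case: ifP => lt_vu.
  rewrite (big_pred1 u) // => w /=; case: eqVneq => [->|_]; first by rewrite lt_vu.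
  by rewrite andbF.
by rewrite big1 // => w /andP[vw /eqP wu]; rewrite -wu vw in lt_vu.
Qed.

(* Descending induction on the rank: the upper sums determine the exponents. *)
Lemma usum_bound (B : nat) : exists C : nat, forall e,
  (forall v, `|usum v e| <= B%:Z) -> forall v, `|e v| <= C%:Z.
Proof.
pose m := \max_v rk v.
suff /(_ m.+1) [C HC] : forall n, exists C : nat, forall e,
    (forall v, `|usum v e| <= B%:Z) ->
    forall v, (m - rk v < n)%N -> `|e v| <= C%:Z.
  by exists C => e He v; apply: HC => //; lia.
elim=> [|n [C HC]]; first by exists 0%N.
(* An exponent is its upper sum, bounded by [B], minus at most [#|V|] exponents of higher rank, each
   bounded by [C]. *)
exists (B + #|V| * C)%N => e He v v_n.
have -> : e v = usum v e - \sum_(w | (rk v < rk w)%N) e w by rewrite /usum; ring.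
apply: (le_trans (ler_normB _ _)); rewrite PoszD; apply: lerD => //.
apply: (le_trans (ler_norm_sum _ _ _)).
apply: (@le_trans _ _ (\sum_(w | (rk v < rk w)%N) C%:Z)).
  apply: ler_sum => w vw; apply: HC => //.
  have : (rk w <= m)%N by apply: leq_bigmax.
  by move: vw v_n; lia.
rewrite sumr_const -mulr_natr natz -PoszM lez_nat mulnC leq_mul2r.
by rewrite max_card orbT.
Qed.

(** The common source of finiteness for all the supports below: bounds on the upper sums bound every
    coordinate. *)
Lemma usum_box (lo hi : V -> int) : exists A : {fset expo V}, forall e,
  (forall v, lo v <= usum v e <= hi v) -> e \in A.
Proof.
pose B := (\sum_v (`|lo v| + `|hi v|))%N.
have [C HC] := usum_bound B.
(* The integers from [- C] to [C] are listed as ordinals shifted by [C]. *)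
exists [fset ([ffun v =>
           (nat_of_ord ((g : {ffun V -> 'I_(2 * C).+1}) v))%:Z - C%:Z] : expo V)
         | g in {: {ffun V -> 'I_(2 * C).+1}}]%fset.
move=> e He.
have {}HC v : `|e v| <= C%:Z.
  apply: HC => w; have := He w; have : (`|lo w| + `|hi w| <= B)%N.
    by rewrite /B (bigD1 w) //= leq_addr.
  lia.
have {}HC v : - C%:Z <= e v <= C%:Z by rewrite -ler_norml HC.
apply/imfsetP; exists [ffun v => inord (absz (e v + C%:Z)%R)] => //.
apply/ffunP => v; rewrite !ffunE.
set x := e v; have : - C%:Z <= x <= C%:Z := HC v.
by move: x => x HCx; rewrite inordK; lia.
Qed.

End Exponents.

(** The [n] such that [z = - n - 1], for [z < 0]. *)
Definition negexp (z : int) : nat := absz (- z - 1).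

Lemma negexpE (z : int) : z < 0 -> z = - (negexp z)%:Z - 1.
Proof. by rewrite /negexp; lia. Qed.

(** * Coefficients of monomials, powers, geometric series and shifted series *)

Section SeriesTheory.
Variables (V : finType) (R : comPzRingType).
Implicit Types (s t x : fseries V R) (u v : V) (e d : expo V) (a b : R).

Lemma eX_add u (m n : int) : eX u (m + n) = eX u m + eX u n.
Proof. by apply/ffunP => w; rewrite !ffunE; case: ifP. Qed.

Lemma eX_opp u (m : int) : eX u (- m) = - eX u m.
Proof. by apply/ffunP => w; rewrite !ffunE; case: ifP; rewrite ?oppr0. Qed.

Lemma eX_sub u (m n : int) : eX u (m - n) = eX u m - eX u n.
Proof. by rewrite eX_add eX_opp. Qed.

Lemma eX0 u : eX u 0 = 0.
Proof. by apply/ffunP => w; rewrite !ffunE; case: ifP. Qed.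

Lemma eXu u (m : int) : eX u m u = m.
Proof. by rewrite eXE eqxx. Qed.

Lemma eX_inj u : injective (eX u).
Proof. by move=> m n /(congr1 (fun e : expo V => e u)); rewrite !eXu. Qed.

Lemma expoB e d u : (e - d) u = e u - d u.
Proof. by rewrite !ffunE. Qed.

Lemma expoD e d u : (e + d) u = e u + d u.
Proof. by rewrite !ffunE. Qed.

Lemma svarXE u (m : int) e : svarX u m e = (e == eX u m)%:R :> R.
Proof. by []. Qed.

Lemma smul_svarXl u (m : int) t e : smul (svarX u m) t e = t (e - eX u m).
Proof.
rewrite /smul (@fsum1 _ _ (eX u m)) ?svarXE ?eqxx ?mul1r // => d.
by rewrite svarXE => /negPf ->; rewrite mul0r.
Qed.

Lemma smul_svarXr u (m : int) t e : smul t (svarX u m) e = t (e - eX u m).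
Proof.
rewrite /smul (@fsum1 _ _ (e - eX u m)) => [|d /eqP de].
  by rewrite svarXE subKr eqxx mulr1.
rewrite svarXE; case: eqP => [ed|_]; last by rewrite mulr0.
by case: de; rewrite -ed subKr.
Qed.

Lemma smul_sconstl a t e : smul (sconst a) t e = a * t e.
Proof.
rewrite /smul (@fsum1 _ _ 0) /sconst ?eqxx ?subr0 // => d /negPf ->.
by rewrite mul0r.
Qed.

Lemma sexp0 x : sexp x 0 = sone. Proof. by []. Qed.
Lemma sexpS x n : sexp x n.+1 = smul x (sexp x n). Proof. by []. Qed.

Lemma sexp_sconst a n : sexp (sconst a : fseries V R) n = sconst (a ^+ n).
Proof.
elim: n => [|n IHn]; first by rewrite expr0.
rewrite sexpS IHn; apply/funext => e; rewrite smul_sconstl exprS /sconst.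
by case: ifP => _; rewrite ?mulr0.
Qed.

Lemma sexp_svar u n : sexp (svar u : fseries V R) n = svarX u n%:Z.
Proof.
elim: n => [|n IHn]; apply/funext => e.
  by rewrite sexp0 svarXE eX0 /sone /sconst; case: eqP.
rewrite sexpS IHn smul_svarXl !svarXE subr_eq -eX_add.
by rewrite addrC -intS.
Qed.

Lemma smul_neq0 s t e : smul s t e != 0 -> exists d, s d != 0 /\ t (e - d) != 0.
Proof.
apply: contra_neqP => /forallNP st0; apply: fsum_eq0 => d.
have /not_andP[/negP | /negP] := st0 d; rewrite negbK => /eqP ->.
  by rewrite mul0r.
by rewrite mulr0.
Qed.

Lemma sone_neq0 e : (sone : fseries V R) e != 0 -> e = 0.
Proof. by rewrite /sone /sconst; case: (e =P 0) => //; rewrite eqxx. Qed.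

(** The property [K] may depend on the power [n], so that bounds on exponents can grow with the
    number of factors. *)
Lemma sexp_supp (K : nat -> expo V -> Prop) x :
  K 0%N 0 -> (forall n d e, x d != 0 -> K n e -> K n.+1 (d + e)) ->
  forall n e, sexp x n e != 0 -> K n e.
Proof.
move=> K0 KS; elim=> [|n IHn] e; first by move=> /sone_neq0 ->.
case/smul_neq0 => d [xd /IHn Ked]; rewrite -(subrK d e) addrC; exact: KS.
Qed.

Lemma sgeom_sconst u a e :
  sgeom u (sconst a) e =
  if (e u < 0) && (e == eX u (e u)) then a ^+ negexp (e u) else 0.
Proof.
have E n : smul (sexp (sconst a) n) (svarX u (- n%:Z - 1)) e =
    if e == eX u (- n%:Z - 1) then a ^+ n else 0.
  by rewrite sexp_sconst smul_sconstl svarXE; case: eqP; rewrite ?mulr1 ?mulr0.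
rewrite /sgeom (eq_fsum E); case: ifP => [/andP[e_lt0 /eqP eE]|H].
  rewrite (@fsum1 _ _ (negexp (e u))) => [|n]; first by rewrite -negexpE // -eE eqxx.
  by move=> n_e; case: eqP => // e_n; move: n_e; rewrite e_n eXu /negexp; lia.
apply: fsum_eq0 => n; case: eqP => // e_n; move: H.
by rewrite e_n eXu eqxx andbT; lia.
Qed.

Lemma sgeom_svar u v e : u != v ->
  sgeom v (svar u) e =
  ((e v < 0) && (e == eX v (e v) + eX u (negexp (e v))%:Z))%:R :> R.
Proof.
move=> uv.
have E n : smul (sexp (svar u) n) (svarX v (- n%:Z - 1)) e =
    (e == eX v (- n%:Z - 1) + eX u n%:Z)%:R :> R.
  by rewrite sexp_svar smul_svarXr svarXE subr_eq addrC.
rewrite /sgeom (eq_fsum E).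
have ev n : e = eX v (- n%:Z - 1) + eX u n%:Z -> e v = - n%:Z - 1.
  by move=> ->; rewrite expoD eXu eXE eq_sym (negPf uv) addr0.
case: (boolP (_ && _)) => [/andP[e_lt0 /eqP eE]|H].
  rewrite (@fsum1 _ _ (negexp (e v))) => [|n]; first by rewrite -negexpE // -eE eqxx.
  by move=> n_e; case: eqP => // /ev ev'; move: n_e; rewrite ev' /negexp; lia.
apply: fsum_eq0 => n; case: eqP => // e_n; move: H; rewrite (ev _ e_n).
by rewrite (_ : negexp _ = n) -?e_n ?eqxx ?andbT /negexp; lia.
Qed.

Lemma sexp_var0 x u : (forall e, x e != 0 -> e u = 0) ->
  forall n e, sexp x n e != 0 -> e u = 0.
Proof.
move=> x0; apply: (@sexp_supp (fun _ e => e u = 0)) => [|n d e /x0 du eu].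
  by rewrite ffunE.
by rewrite expoD du eu.
Qed.

(** As [x] does not involve [u], the exponent of [u] in [u ^ (a - n) x ^ n] is [a - n]. Hence [e u]
    determines [n] from [a], and the inner sum has at most one nonzero term. *)
Lemma sshift_coef (q : int -> R) u x e : (forall e, x e != 0 -> e u = 0) ->
  sshift q u x e =
  \fsum_(a : int) (if e u <= a then
     q a * (sexp x (absz (a - e u)) (e - eX u (e u)) *~ binz a (absz (a - e u)))
     else 0).
Proof.
move=> x0; apply: eq_fsum => a.
under eq_fsum do rewrite smul_svarXl.
have n0 n : sexp x n (e - eX u (a - n%:Z)) != 0 -> a - n%:Z = e u.
  by move=> /(sexp_var0 x0); rewrite expoB eXu; lia.
case: ifP => ea.
  rewrite (@fsum1 _ _ (absz (a - e u))) => [|n].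
    by rewrite (_ : a - _ = e u) //; lia.
  move=> na; have /eqP -> : sexp x n (e - eX u (a - n%:Z)) == 0.
    by apply: contraNT na => /n0; lia.
  by rewrite mul0rz.
rewrite fsum_eq0 ?mulr0 // => n.
have /eqP -> : sexp x n (e - eX u (a - n%:Z)) == 0; last by rewrite mul0rz.
by apply: contraFT ea => /n0; lia.
Qed.

Lemma sconst_neq0 a e : (sconst a : fseries V R) e != 0 -> e = 0.
Proof. by rewrite /sconst; case: (e =P 0) => //; rewrite eqxx. Qed.

Lemma sshift_sconst (q : int -> R) u b e :
  sshift q u (sconst b) e =
  if e == eX u (e u) then
    \fsum_(a : int) (if e u <= a then
       q a * (b ^+ absz (a - e u) *~ binz a (absz (a - e u))) else 0)
  else 0.
Proof.
rewrite sshift_coef => [|d /sconst_neq0 ->]; last by rewrite ffunE.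
case: ifP => H; first apply: eq_fsum => a.
  by rewrite sexp_sconst /sconst subr_eq0 H.
by apply: fsum_eq0 => a; rewrite sexp_sconst /sconst subr_eq0 H mul0rz mulr0 if_same.
Qed.

End SeriesTheory.

(** * One-variable series inside several variables *)

Section Embedding.
Variables (V : finType) (R : comPzRingType) (u : V).
Implicit Types (s t : fseries unit R).

(** The hypothesis on push-forwards concerns series in the single variable [tt]; this renames [tt]
    to [u] among the variables of the theorem. *)
Definition emb s : fseries V R :=
  fun e => if e == eX u (e u) then s (eX tt (e u)) else 0.

Lemma expo_unit (g : expo unit) : g = eX tt (g tt).
Proof. by apply/ffunP => - []; rewrite eXu. Qed.

Lemma emb_smul s t : emb (smul s t) = smul (emb s) (emb t).
Proof.
apply/funext => e; rewrite [RHS]/smul.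
rewrite (@fsum_inj _ _ _ (fun g : expo unit => eX u (g tt))) => [|g g' /eX_inj gg'|d].
- rewrite /emb; case: ifP => [/eqP eE|eE].
    apply: eq_fsum => g; rewrite !eXu eqxx -expo_unit expoB eXu.
    move: (e u) eE => m ->; rewrite -eX_sub eqxx.
    by rewrite eX_sub -expo_unit.
  apply/esym/fsum_eq0 => g; rewrite expoB eXu eX_sub.
  by rewrite (can_eq (subrK _)) eE mulr0.
- by rewrite (expo_unit g) gg' -expo_unit.
- rewrite /emb; case: ifP => [/eqP dE _|_]; last by rewrite mul0r eqxx.
  by exists (eX tt (d u)); rewrite eXu.
Qed.

Lemma emb_sconst a : emb (sconst a) = sconst a.
Proof.
apply/funext => e; rewrite /emb /sconst.
case: (e =P 0) => [->|e0]; first by rewrite !ffunE !eX0 !eqxx.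
case: eqP => // eE; case: eqP => // /(congr1 (fun g : expo unit => g tt)).
by rewrite eXu ffunE => eu; case: e0; rewrite eE eu eX0.
Qed.

Lemma emb_sshift (q : int -> R) b :
  emb (sshift q tt (sconst b)) = sshift q u (sconst b).
Proof.
apply/funext => e; rewrite /emb !sshift_sconst; case: ifP => // _.
by rewrite !eXu eqxx.
Qed.

Lemma emb_sprod (I : Type) (r : seq I) (F : I -> fseries unit R) :
  emb (\sprod_(i <- r) F i) = \sprod_(i <- r) emb (F i).
Proof.
elim: r => [|i r IHr]; first by rewrite !big_nil; exact: emb_sconst.
by rewrite !big_cons emb_smul IHr.
Qed.

End Embedding.

(** * Bounded upper sums and non-negative exponents *)

Section Support.
Variables (V : finType) (rk : V -> nat) (R : comPzRingType).
Implicit Types (s t x : fseries V R) (P : pred V).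

(** Only upper bounds are recorded: the lower bounds come from the monomial whose coefficient is
    being computed. *)
Definition ubounded s := exists N : int, forall e, s e != 0 ->
  forall v, usum rk v e <= N.

Definition nonneg_on P s := forall e v, s e != 0 -> P v -> 0 <= e v.

Lemma ubounded_sone : ubounded sone.
Proof. by exists 0 => e /sone_neq0 -> v; rewrite usum0. Qed.

Lemma nonneg_sone P : nonneg_on P sone.
Proof. by move=> e v /sone_neq0 -> _; rewrite ffunE. Qed.

Lemma ubounded_smul s t : ubounded s -> ubounded t -> ubounded (smul s t).
Proof.
move=> [N HN] [N' HN']; exists (N + N') => e /smul_neq0 [d [sd ted]] v.
by rewrite -(subrK d e) usumD addrC lerD ?HN ?HN'.
Qed.

Lemma nonneg_smul P s t :
  nonneg_on P s -> nonneg_on P t -> nonneg_on P (smul s t).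
Proof.
move=> Hs Ht e v /smul_neq0 [d [sd ted]] Pv.
by rewrite -(subrK d e) expoD addr_ge0 ?(Hs _ _ sd) ?(Ht _ _ ted).
Qed.

Lemma ubounded_sprod (I : eqType) (r : seq I) (F : I -> fseries V R) :
  (forall i, i \in r -> ubounded (F i)) -> ubounded (\sprod_(i <- r) F i).
Proof.
move=> HF; rewrite big_seq; elim/big_rec: _ => [|i s ri Hs]; first exact: ubounded_sone.
by apply: ubounded_smul => //; apply: HF.
Qed.

Lemma nonneg_sprod P (I : eqType) (r : seq I) (F : I -> fseries V R) :
  (forall i, i \in r -> nonneg_on P (F i)) -> nonneg_on P (\sprod_(i <- r) F i).
Proof.
move=> HF; rewrite big_seq; elim/big_rec: _ => [|i s ri Hs]; first exact: nonneg_sone.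
by apply: nonneg_smul => //; apply: HF.
Qed.

Lemma ubounded_sexp x n : ubounded x -> ubounded (sexp x n).
Proof.
by move=> Hx; elim: n => [|n IHn]; [exact: ubounded_sone | exact: ubounded_smul].
Qed.

Lemma nonneg_sexp P x n : nonneg_on P x -> nonneg_on P (sexp x n).
Proof.
by move=> Hx; elim: n => [|n IHn]; [exact: nonneg_sone | exact: nonneg_smul].
Qed.

Lemma sshift_neq0 (q : int -> R) u x e : (forall e, x e != 0 -> e u = 0) ->
  sshift q u x e != 0 -> exists a, [/\ q a != 0, e u <= a &
    sexp x (absz (a - e u)) (e - eX u (e u)) != 0].
Proof.
move=> x0; rewrite sshift_coef //; apply: contra_neqP => /forallNP H.
apply: fsum_eq0 => a; case: ifP => // ea; apply/eqP/negP => /negP nz.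
apply: (H a); split=> //; apply: contraNneq nz => ->; first by rewrite mul0r.
by rewrite mul0rz mulr0.
Qed.

Lemma sshift_supp0 (q : int -> R) u x w : u != w ->
  (forall e, x e != 0 -> e u = 0) -> (forall e, x e != 0 -> e w = 0) ->
  forall e, sshift q u x e != 0 -> e w = 0.
Proof.
move=> uw x0 xw e /(sshift_neq0 x0)[a [_ _ /(sexp_var0 xw)]].
by rewrite expoB eXE eq_sym (negPf uw) subr0.
Qed.

(** In [u ^ (a - n) x ^ n], each factor [x] adds at most 1 to an upper sum at a variable of rank
    below that of [u], and this is compensated by the loss of one power of [u]; what remains is at
    most [a], hence at most [N]. *)
Lemma ubounded_sshift (q : int -> R) u x : laurent q ->
  (forall e, x e != 0 -> e u = 0) ->
  (forall e, x e != 0 -> forall v, usum rk v e <= (rk v < rk u)%N%:R) ->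
  ubounded (sshift q u x).
Proof.
(* The absolute value is taken because [N] may be negative, while the upper sums at variables not
   below [u] and distinct from it are only known to be at most 0. *)
move=> [N HN] x0 xu; exists `|N| => e /(sshift_neq0 x0)[a [qa ea xe]] v.
have aN : a <= N by rewrite leNgt; apply: contraNN qa => /HN ->.
have : usum rk v (e - eX u (e u)) <= (rk v < rk u)%N%:R * (absz (a - e u))%:R.
  move: (absz _) xe => n; apply: (@sexp_supp _ _
    (fun n d => usum rk v d <= (rk v < rk u)%N%:R * n%:R)) => [|m d d' xd IH].
    by rewrite usum0 mulr0.
  by rewrite usumD -natr1 mulrDr mulr1 addrC lerD ?xu.
rewrite usumB usum_eX; set z := usum _ _ _; set k := e u in ea *.
by rewrite natz; case: eqP => [->|_]; rewrite ?ltnn /=;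
  case: (rk v < rk u)%N => /=; lia.
Qed.

Lemma nonneg_sshift P (q : int -> R) u x :
  (forall e, x e != 0 -> e u = 0) -> ~~ P u -> nonneg_on P x ->
  nonneg_on P (sshift q u x).
Proof.
move=> x0 Pu Px e v /(sshift_neq0 x0)[a [_ _ /(nonneg_sexp Px) H]] Pv.
have := H v Pv; rewrite expoB eXE; case: eqP => [vu|_]; last by rewrite subr0.
by rewrite vu (negPf Pu) in Pv.
Qed.

(** The monomials are [v ^ (- n - 1) u ^ n], and an upper sum that counts [u] also counts [v]. *)
Lemma ubounded_sgeom_svar u v : (rk u < rk v)%N -> ubounded (sgeom v (svar u)).
Proof.
move=> uv; have nuv : u != v by apply: contraTneq uv => ->; rewrite ltnn.
exists 0 => e; rewrite sgeom_svar // => H w.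
have /andP[e0 /eqP ->] : (e v < 0) && (e == eX v (e v) + eX u (negexp (e v))%:Z).
  by apply: contraNT H => /negPf ->.
rewrite usumD !usum_eX /negexp; set k := e v in e0 *.
case: (w =P u) => [->|_]; first by rewrite uv orbT /=; lia.
case: (ltnP (rk w) (rk u)) => [wu|_] /=; last by case: ifP => _; lia.
by rewrite (ltn_trans wu uv) orbT; lia.
Qed.

Lemma nonneg_sgeom_svar P u v : u != v -> ~~ P v -> nonneg_on P (sgeom v (svar u)).
Proof.
move=> uv Pv e w; rewrite sgeom_svar // => H Pw.
have /andP[e0 /eqP ->] : (e v < 0) && (e == eX v (e v) + eX u (negexp (e v))%:Z).
  by apply: contraNT H => /negPf ->.
rewrite expoD !eXE; case: eqP => [wv|_]; first by rewrite wv (negPf Pv) in Pw.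
by rewrite add0r; case: ifP.
Qed.

End Support.

Lemma bigfcup_cover (I J : choiceType) (A : {fset I}) (B : I -> {fset J}) :
  exists C : {fset J}, forall i j, i \in A -> j \in B i -> j \in C.
Proof.
exists (\bigcup_(i <- A) B i)%fset => i j iA jB.
by apply/bigfcupP; exists i; rewrite // iA.
Qed.

(** * Substitution of classes for variables, and its multiplicativity *)

Section Specialization.
Variables (V : finType) (rk : V -> nat) (R R' : comPzRingType).
Variables (h : {rmorphism R -> R'}) (P : pred V) (y : V -> R').
Implicit Types (s t x : fseries V R) (e d f : expo V).

(** Under the substitution below, the monomial [e] becomes the coefficient [wt e] times the monomial
    [kill e]. *)
Definition kill e : expo V := [ffun v => if P v then 0 else e v].

Definition wt e : R' := \prod_(v | P v) y v ^+ absz (e v).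

(** The substitution [v |-> y v] for [v] in [P], with [h] applied to the
    coefficients. Junk if [s] has negative exponents on [P] ([wt] takes absolute
    values) or if the sum is not finite. *)
Definition spec s : fseries V R' :=
  fun f => \fsum_(e : expo V) (if kill e == f then h (s e) * wt e else 0).

Lemma killE e v : kill e v = if P v then 0 else e v.
Proof. by rewrite ffunE. Qed.

Lemma killD e d : kill (e + d) = kill e + kill d.
Proof. by apply/ffunP => v; rewrite !ffunE; case: ifP. Qed.

Lemma killB e d : kill (e - d) = kill e - kill d.
Proof. by apply/ffunP => v; rewrite !ffunE; case: ifP. Qed.

Lemma kill0 : kill 0 = 0.
Proof. by apply/ffunP => v; rewrite !ffunE; case: ifP. Qed.

Lemma kill_eX u (a : int) : ~~ P u -> kill (eX u a) = eX u a.
Proof.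
by move=> Pu; apply/ffunP => v; rewrite !ffunE; case: eqP => [->|];
  rewrite ?(negPf Pu) ?if_same.
Qed.

Lemma wt0 : wt 0 = 1.
Proof. by rewrite /wt big1 // => v _; rewrite ffunE expr0. Qed.

Lemma wtD e d : (forall v, P v -> 0 <= e v) -> (forall v, P v -> 0 <= d v) ->
  wt (e + d) = wt e * wt d.
Proof.
move=> He Hd; rewrite /wt -big_split; apply: eq_bigr => v Pv /=.
rewrite -exprD expoD; congr (_ ^+ _).
by move: (He v Pv) (Hd v Pv); move: (e v) (d v) => a b; lia.
Qed.

Lemma usum_kill e v : (forall v, P v -> 0 <= e v) -> usum rk v (kill e) <= usum rk v e.
Proof.
move=> He; have K w : kill e w <= e w by rewrite ffunE; case: ifP => // /He.
by apply: lerD => //; apply: ler_sum => w _.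
Qed.

(** Killing non-negative exponents can only lower the upper sums. Those of [e] therefore lie between
    those of [f] and the bound [N]. *)
Lemma fiber_finite s f : ubounded rk s -> nonneg_on P s ->
  exists A : {fset expo V}, forall e, kill e = f -> s e != 0 -> e \in A.
Proof.
move=> [N HN] Hs; have [A HA] := usum_box rk (fun v => usum rk v f) (fun=> N).
exists A => e ef se; apply: HA => v; rewrite HN // andbT -ef usum_kill //.
by move=> w; apply: Hs.
Qed.

Lemma spec_neq0 s f : spec s f != 0 -> exists e, kill e = f /\ s e != 0.
Proof.
apply: contra_neqP => /forallNP H; apply: fsum_eq0 => e; case: eqP => // ef.
have /not_andP[//|/negP] := H e; rewrite negbK => /eqP ->.
by rewrite rmorph0 mul0r.
Qed.

Lemma spec_sconst a : spec (sconst a) = sconst (h a).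
Proof.
apply/funext => f; rewrite /spec (@fsum1 _ _ 0) => [|e /negPf e0]; last first.
  by rewrite /sconst e0 rmorph0 mul0r if_same.
by rewrite kill0 wt0 /sconst eqxx mulr1 eq_sym.
Qed.

Lemma spec_off s : (forall e v, s e != 0 -> P v -> e v = 0) ->
  spec s = fun f => h (s f).
Proof.
move=> s0; have sK e : s e != 0 -> kill e = e.
  by move=> se; apply/ffunP => v; rewrite ffunE; case: ifP => // /(s0 _ _ se).
apply/funext => f; rewrite /spec (@fsum1 _ _ f) => [|e ef].
  have [->|sf] := eqVneq (s f) 0; first by rewrite rmorph0 mul0r if_same.
  rewrite sK // eqxx /wt big1 ?mulr1 // => v /(s0 _ _ sf) ->.
  by rewrite expr0.
have [->|/sK ->] := eqVneq (s e) 0; first by rewrite rmorph0 mul0r if_same.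
by rewrite (negPf ef).
Qed.

Let sw s e := h (s e) * wt e.

Let sw_neq0 s e : sw s e != 0 -> s e != 0.
Proof. by apply: contraNneq => s0; rewrite /sw s0 rmorph0 mul0r. Qed.

(** Both sides sum [sw s d * sw t e] over the pairs with [kill (d + e) = f]. The support conditions
    leave finitely many such pairs, so they may be grouped by [d + e] or by [kill d]. *)
Lemma spec_smul s t : ubounded rk s -> ubounded rk t -> nonneg_on P s -> nonneg_on P t ->
  spec (smul s t) = smul (spec s) (spec t).
Proof.
move=> bs bt ps pt; apply/funext => f.
(* The upper sums of [d] are at most [N], and at least those of [f] minus the bound [N'] for [e]. *)
have [A HA] : exists A : {fset expo V}, forall d e, kill (d + e) = f ->
    s d != 0 -> t e != 0 -> d \in A.
  case: (bs) (bt) => [N HN] [N' HN'].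
  have [A HA] := usum_box rk (fun v => usum rk v f - N') (fun=> N).
  exists A => d e def sd te; apply: HA => v; rewrite HN // andbT.
  rewrite lerBlDr; apply: (@le_trans _ _ (usum rk v (d + e))).
    by rewrite -def usum_kill // => w Pw; rewrite expoD addr_ge0 ?(ps _ _ sd) ?(pt _ _ te).
  by rewrite usumD lerD2l HN'.
have [B HB] := fiber_finite f (ubounded_smul bs bt) (nonneg_smul ps pt).
have [B' HB'] : exists B : {fset expo V}, forall d e, kill e = f ->
    s d != 0 -> t (e - d) != 0 -> e \in B.
  case: (bs) (bt) => [N HN] [N' HN'].
  have [B' HB'] := usum_box rk (fun v => usum rk v f) (fun=> N + N').
  exists B' => d e ef sd ted; apply: HB' => v; rewrite -ef usum_kill /=; last first.
    by move=> w Pw; rewrite -(subrK d e) expoD addr_ge0 ?(ps _ _ sd) ?(pt _ _ ted).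
  by rewrite -(subrK d e) usumD addrC lerD ?HN ?HN'.
transitivity (\fsum_(e : expo V) \fsum_(d : expo V)
    (if kill e == f then sw s d * sw t (e - d) else 0)).
  apply: eq_fsum => e; case: eqP => [ef|_]; last by rewrite fsum_eq0.
  rewrite (@raddf_fsum _ _ _ h A) => [|d]; last first.
    by move=> /mulr_neq0W [sd te]; apply: (HA d (e - d)); rewrite // addrC subrK.
  rewrite (@mulr_fsum_l _ _ A) => [|d]; last first.
    rewrite /= rmorphM => /mulr_neq0W [hs ht]; have [sd te] : s d != 0 /\ t (e - d) != 0.
      by split; [move: hs | move: ht]; apply: contraNneq => ->; rewrite rmorph0.
    by apply: (HA d (e - d)); rewrite // addrC subrK.
  apply: eq_fsum => d; rewrite /= rmorphM /sw.
  have [->|sd] := eqVneq (s d) 0; first by rewrite rmorph0 !mul0r.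
  have [->|ted] := eqVneq (t (e - d)) 0; first by rewrite rmorph0 !(mulr0, mul0r).
  rewrite mulrACA -wtD; first by rewrite subrKC.
    by move=> v; apply: ps.
  by move=> v; apply: pt.
rewrite (@fsum_exchange _ _ _ B' A); first last.
- move=> e d /if_neq0 [/eqP ef] /mulr_neq0W [/sw_neq0 sd /sw_neq0 ted].
  by apply: (HA d (e - d)); rewrite // addrC subrK.
- by move=> e d /if_neq0 [/eqP ef] /mulr_neq0W [/sw_neq0 sd /sw_neq0 ted]; apply: (HB' d).
(* For fixed [d], the translation by [d] turns the inner sum into a coefficient of [spec t]. *)
transitivity (\fsum_(d : expo V) (sw s d * spec t (f - kill d))).
  apply: eq_fsum => d.
  rewrite (@fsum_inj _ _ _ (fun e => e + d)) => [|e e' /addIr //|e _]; last first.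
    by exists (e - d); rewrite subrK.
  have [C HC] := fiber_finite (f - kill d) bt pt.
  rewrite (@mulr_fsum_r _ _ C) => [|e /if_neq0 [/eqP ed] /sw_neq0 te]; last exact: HC.
  apply: eq_fsum => e; rewrite killD addrK -subr_eq opprK.
  by rewrite eq_sym -subr_eq eq_sym; case: ifP; rewrite ?mulr0.
(* From the other side, the coefficient of [spec s] at [g] is spread over the [d] in the fibre of
   [g]. *)
apply/esym; transitivity (\fsum_(g : expo V) \fsum_(d : expo V)
    ((if kill d == g then sw s d else 0) * spec t (f - g))).
  apply: eq_fsum => g; have [C HC] := fiber_finite g bs ps.
  rewrite -(@mulr_fsum_l _ _ C) // => d /if_neq0 [/eqP dg] /sw_neq0 sd; exact: HC.
have HF d g : (if kill d == g then sw s d else 0) * spec t (f - g) != 0 ->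
    kill d = g /\ d \in A.
  move=> /mulr_neq0W [/if_neq0 [/eqP dg] /sw_neq0 sd] /spec_neq0 [e [ef te]]; split=> //.
  by apply: (HA d e) => //; rewrite killD dg ef addrC subrK.
rewrite (@fsum_exchange _ _ _ [fset kill d | d in A]%fset A); first last.
- by move=> g d /HF [].
- by move=> g d /HF [<- dA]; apply/imfsetP; exists d.
apply: eq_fsum => d; rewrite (@fsum1 _ _ (kill d)) ?eqxx // => g.
by rewrite eq_sym => /negPf ->; rewrite mul0r.
Qed.

End Specialization.

(** * Substitution in products, powers and shifted series *)

Section SpecializationShift.
Variables (V : finType) (rk : V -> nat) (R R' : comPzRingType).
Variables (h : {rmorphism R -> R'}) (P : pred V) (y : V -> R').
Implicit Types (s t x : fseries V R) (e d f : expo V).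

Local Notation sp := (spec h P y).

Lemma spec_sone : sp sone = sone.
Proof. by rewrite spec_sconst rmorph1. Qed.

Lemma spec_sprod (I : eqType) (r : seq I) (F : I -> fseries V R) :
  (forall i, i \in r -> ubounded rk (F i)) ->
  (forall i, i \in r -> nonneg_on P (F i)) ->
  sp (\sprod_(i <- r) F i) = \sprod_(i <- r) sp (F i).
Proof.
elim: r => [|i r IHr] bF pF; first by rewrite !big_nil spec_sone.
have bF' j : j \in r -> ubounded rk (F j) by move=> jr; apply: bF; rewrite inE jr orbT.
have pF' j : j \in r -> nonneg_on P (F j).
  by move=> jr; apply: pF; rewrite inE jr orbT.
rewrite !big_cons (spec_smul (rk := rk)) ?IHr //.
- by apply: bF; rewrite mem_head.
- exact: ubounded_sprod.
- by apply: pF; rewrite mem_head.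
- exact: nonneg_sprod.
Qed.

Lemma spec_sexp x n : ubounded rk x -> nonneg_on P x ->
  sp (sexp x n) = sexp (sp x) n.
Proof.
move=> bx px; elim: n => [|n IHn]; first by rewrite sexp0 spec_sone.
by rewrite !sexpS (spec_smul (rk := rk)) ?IHn //; [apply: ubounded_sexp|apply: nonneg_sexp].
Qed.


Lemma spec_svar u : P u -> sp (svar u) = sconst (y u).
Proof.
move=> Pu; apply/funext => f; rewrite /spec.
rewrite (@fsum1 _ _ (eX u 1)) => [|e e1]; last first.
  by rewrite /svar svarXE (negPf e1) rmorph0 mul0r if_same.
rewrite /svar svarXE eqxx rmorph1 mul1r /wt (bigD1 u) //= eXu expr1 big1 ?mulr1.
  rewrite /sconst eq_sym; congr (if f == _ then _ else _).
  by apply/ffunP => v; rewrite !ffunE; case: eqP => [->|]; rewrite ?Pu ?if_same.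
by move=> v /andP[_ vu]; rewrite eXE (negPf vu) expr0.
Qed.

(** Additivity of the substitution is available here because all the series involved are supported
    in one finite set of monomials. *)
Lemma spec_sum_svar (I : finType) (v : I -> V) (m : I -> int) :
  (forall i, P (v i)) ->
  sp (fun e => \sum_i svar (v i) e *~ m i) = sconst (\sum_i y (v i) *~ m i).
Proof.
move=> Pv; apply/funext => f.
pose A : {fset expo V} := [fset eX (v i) 1 | i in I]%fset.
have HA i e : e \notin A -> (svar (v i) e : R) = 0.
  move=> eA; rewrite /svar svarXE; case: eqP => // ee; case/negP: eA.
  by rewrite ee; apply/imfsetP; exists i.
have sA (g : expo V -> R) : (forall e, e \notin A -> g e = 0) ->
    sp g f = \sum_(e <- A) (if kill P e == f then h (g e) * wt P y e else 0).
  move=> gA; apply: fsumE => e; apply: contraR => /gA ->.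
  by rewrite rmorph0 mul0r if_same.
transitivity (\sum_i sp (svar (v i)) f *~ m i).
  rewrite sA => [|e eA]; last by rewrite big1 // => i _; rewrite HA // mul0rz.
  rewrite (eq_bigr _ (fun i _ => congr1 (fun z => z *~ m i) (sA _ (HA i)))).
  under [RHS]eq_bigr do rewrite mulrz_suml.
  rewrite exchange_big; apply: eq_bigr => e _ /=; case: eqP => _; last first.
    by rewrite big1 // => i _; rewrite mul0rz.
  by rewrite rmorph_sum mulr_suml; apply: eq_bigr => i _; rewrite rmorphMz mulrzAl.
under eq_bigr do rewrite spec_svar //.
by rewrite /sconst; case: eqP => // _; rewrite big1 // => i _; rewrite mul0rz.
Qed.

(** The left-hand side is a double sum over monomials and over exponents [a] of [q]. The exponent of
    [u] bounds [a] below and the Laurent condition bounds it above, so the sums can be exchanged;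
    the substitution then acts on each power of [x]. *)
Lemma spec_sshift (q : int -> R) u x b : laurent q -> ~~ P u ->
  (forall e, x e != 0 -> e u = 0) -> ubounded rk x -> nonneg_on P x ->
  sp x = sconst b ->
  sp (sshift q u x) = sshift (fun a => h (q a)) u (sconst b).
Proof.
move=> [N HN] Pu x0 bx px xb; apply/funext => f.
pose K := f u; pose n (a : int) := absz (a - K).
(* [D] contains every [a] with [K <= a <= N]. *)
pose D : {fset int} :=
  [fset ((K : int) + (i : nat)%:Z)%R | i in iota 0 (absz (N - K)).+1]%fset.
have HD a : K <= a -> q a != 0 -> a \in D.
  move=> Ka qa; have aN : a <= N by rewrite leNgt; apply: contraNN qa => /HN ->.
  apply/imfsetP; exists (absz (a - K)) => /=; last by rewrite /n; lia.
  have : absz (a - K) \in iota 0 (absz (N - K)).+1 by rewrite mem_iota; lia.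
  by [].
have [A HA] : exists A : {fset expo V}, forall a e, a \in D -> kill P e = f ->
    sexp x (n a) (e - eX u K) != 0 -> e \in A.
  have H (a : int) : exists A : {fset expo V}, forall e, kill P e = f ->
      sexp x (n a) (e - eX u K) != 0 -> e \in A.
    have [A HA] := fiber_finite (f - eX u K)
      (ubounded_sexp (n a) bx) (@nonneg_sexp _ _ _ _ (n a) px).
    exists [fset ((e : expo V) + eX u K)%R | e in A]%fset => e ef xe.
    apply/imfsetP; exists (e - eX u K); last by rewrite subrK.
    by apply: HA => //; rewrite killB kill_eX // ef.
  have [B HB] := boolp.choice H.
  have [A HA] := bigfcup_cover D B.
  by exists A => a e aD ef xe; apply: (HA a) => //; apply: HB.
pose G (e : expo V) (a : int) : R' := if kill P e == f then
  (if K <= a then h (q a) * (h (sexp x (n a) (e - eX u K)) *~ binz a (n a)) else 0) *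
    wt P y e else 0.
have HG e a : G e a != 0 -> [/\ kill P e = f, K <= a, q a != 0 &
    sexp x (n a) (e - eX u K) != 0].
  move=> /if_neq0 [/eqP ef]; case: ifP => [Ka|_]; last by rewrite mul0r eqxx.
  move=> nz; split=> //; apply: contraNneq nz => ->; rewrite rmorph0 ?mul0r //.
  by rewrite mul0rz mulr0 mul0r.
(* The variable [u] survives the substitution, so its exponent can be read off [f]. *)
have xK e : kill P e = f -> e u = K by rewrite /K => <-; rewrite killE (negPf Pu).
transitivity (\fsum_(e : expo V) \fsum_(a : int) G e a).
  apply: eq_fsum => e; rewrite /G; case: eqP => [ef|_]; last by rewrite fsum_eq0.
  rewrite sshift_coef // xK // (@raddf_fsum _ _ _ h D) => [|a]; last first.
    move=> nz; have Ka : K <= a by move: nz; case: ifP => //; rewrite eqxx.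
    by apply: HD => //; apply: contraNneq nz => ->; rewrite mul0r if_same.
  rewrite (@mulr_fsum_l _ _ D) => [|a]; last first.
    move=> nz; have Ka : K <= a.
      by move: nz; case: ifP => //; rewrite raddf0 eqxx.
    by apply: HD => //; apply: contraNneq nz => ->; rewrite mul0r if_same raddf0.
  by apply: eq_fsum => a; case: ifP => _; rewrite /= ?rmorph0 // rmorphM rmorphMz.
rewrite (@fsum_exchange _ _ _ A D); first last.
- by move=> e a /HG [_ Ka qa _]; apply: HD.
- by move=> e a /HG [ef Ka qa xe]; apply: (HA a) => //; apply: HD.
transitivity (\fsum_(a : int) (if K <= a then
    h (q a) *~ binz a (n a) * sp (sexp x (n a)) (f - eX u K) else 0)).
  apply: eq_fsum => a; rewrite /G; case: ifP => Ka; last first.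
    by apply: fsum_eq0 => e; rewrite mul0r if_same.
  rewrite (@fsum_inj _ _ _ (fun e => e + eX u K)) => [|e e' /addIr //|e _]; last first.
    by exists (e - eX u K); rewrite subrK.
  have [C HC] := fiber_finite (f - eX u K)
      (ubounded_sexp (n a) bx) (@nonneg_sexp _ _ _ _ (n a) px).
  rewrite (@mulr_fsum_r _ _ C) => [|e /if_neq0 [/eqP ed] nz]; last first.
    by apply: HC => //; apply: contraNneq nz => ->; rewrite rmorph0 mul0r.
  apply: eq_fsum => e; rewrite killD addrK kill_eX // [in RHS]eq_sym subr_eq eq_sym.
  case: eqP => _; rewrite ?mulr0 // mulrzAr !mulrzAl -mulrA.
  congr (_ * (_ * _) *~ _); apply: eq_bigr => v Pv.
  rewrite expoD eXE; case: eqP => [vu|_]; last by rewrite addr0.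
  by rewrite vu (negPf Pu) in Pv.
rewrite sshift_sconst; case: ifP => fK; first apply: eq_fsum => a.
  case: ifP => // Ka; rewrite spec_sexp // xb sexp_sconst /sconst subr_eq0 fK.
  by rewrite mulrzAl mulrzAr.
apply: fsum_eq0 => a; case: ifP => // Ka.
by rewrite spec_sexp // xb sexp_sconst /sconst subr_eq0 fK mulr0.
Qed.

End SpecializationShift.

(** Substituting for one more variable [u] can be done after substituting for the others, by summing
    over the exponent [b] of [u]. The explicit finite set [B] makes this an ordinary sum, through
    which a push-forward can be taken. *)
Lemma spec_step (V : finType) (rk : V -> nat) (R R1 R2 : comPzRingType)
    (h1 : {rmorphism R -> R1}) (h2 : {rmorphism R -> R2})
    (g : {rmorphism R1 -> R2}) (P1 P2 : pred V) (y1 : V -> R1) (y2 : V -> R2)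
    (u : V) (s : fseries V R) (f : expo V) :
  (forall a, h2 a = g (h1 a)) -> ~~ P1 u -> (forall v, P2 v = (v == u) || P1 v) ->
  (forall v, P1 v -> y2 v = g (y1 v)) -> ubounded rk s -> nonneg_on P2 s -> f u = 0 ->
  exists B : {fset nat},
    (forall b, b \notin B -> spec h1 P1 y1 s (f + eX u b%:Z) = 0) /\
    spec h2 P2 y2 s f =
    \sum_(b <- B) y2 u ^+ b * g (spec h1 P1 y1 s (f + eX u b%:Z)).
Proof.
move=> hE Pu PE yE bs ps fu.
have P2u : P2 u by rewrite PE eqxx.
have ps1 : nonneg_on P1 s by move=> e v se Pv; apply: (ps e v se); rewrite PE Pv orbT.
have [A HA] := fiber_finite f bs ps.
(* As [f u = 0], the fibre of [kill P1] over [f] times [u ^ b] is the part of the fibre of [kill P2]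
   over [f] where [u] has exponent [b]. *)
have kE e b : (kill P1 e == f + eX u b) = (kill P2 e == f) && (e u == b).
  apply/eqP/andP => [ef|[/eqP <- /eqP <-]].
    have eu : e u = b.
      move/(congr1 (fun d : expo V => d u)): ef.
      by rewrite killE (negPf Pu) expoD fu eXu add0r.
    split; last exact/eqP.
    apply/eqP/ffunP => v; rewrite killE PE; case: eqP => [->|vu] //=.
    move/(congr1 (fun d : expo V => d v)): ef; rewrite killE expoD eXE.
    by case: eqP => //; rewrite addr0.
  apply/ffunP => v; rewrite expoD !killE eXE PE; case: eqP => [->|_] /=.
    by rewrite (negPf Pu) add0r.
  by rewrite addr0.
pose B : {fset nat} := [fset absz ((e : expo V) u) | e in A]%fset.
have H1 e b : kill P1 e = f + eX u b%:Z -> s e != 0 -> e \in A /\ b \in B.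
  move=> /eqP; rewrite kE => /andP[/eqP ef /eqP eu] se.
  have eA : e \in A by apply: HA.
  by split=> //; apply/imfsetP; exists e => //; rewrite eu.
have HB b : b \notin B -> spec h1 P1 y1 s (f + eX u b%:Z) = 0.
  by apply: contraNeq => /spec_neq0 [e [ef se]]; case: (H1 e b).
exists B; split=> //.
pose F e (b : nat) : R2 := if kill P1 e == f + eX u b%:Z then
  y2 u ^+ b * g (h1 (s e) * wt P1 y1 e) else 0.
have HF e b : F e b != 0 -> e \in A /\ b \in B.
  move=> /if_neq0 [/eqP ef] nz; apply: H1 => //; apply: contraNneq nz => ->.
  by rewrite rmorph0 mul0r rmorph0 mulr0.
transitivity (\fsum_(e : expo V) \fsum_(b : nat) F e b).
  apply: eq_fsum => e; have [se|se] := eqVneq (s e) 0.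
    rewrite se rmorph0 mul0r if_same fsum_eq0 // => b.
    by rewrite /F se rmorph0 mul0r rmorph0 mulr0 if_same.
  have eu : e u = (absz (e u))%:Z by rewrite gez0_abs // (ps _ _ se).
  rewrite (@fsum1 _ _ (absz (e u))) => [|b].
    rewrite /F kE -eu eqxx andbT; case: ifP => // _.
    rewrite rmorphM -hE mulrCA; congr (_ * _).
    rewrite /wt rmorph_prod (bigD1 u) //=; congr (_ * _).
    apply: eq_big => [v|v /andP[]]; rewrite PE.
      by case: eqP => [->|]; rewrite ?(negPf Pu) ?andbT ?andbF.
    by case: eqP => //= _ Pv _; rewrite rmorphXn yE.
  by rewrite /F kE [in e u == _]eu eqz_nat eq_sym => /negPf ->; rewrite andbF.
rewrite (@fsum_exchange _ _ _ A B); try by move=> e b /HF [].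
rewrite (@fsumE _ _ B) => [|b nz]; last first.
  apply: contraNT nz => bB; apply/eqP/fsum_eq0 => e; apply/eqP.
  by apply: contraNT bB => /HF [].
apply: eq_bigr => b _; have [C HC] := fiber_finite (f + eX u b%:Z) bs ps1.
rewrite [spec _ _ _ _ _]/spec.
rewrite (@raddf_fsum _ _ _ g C) => [|e /if_neq0 [/eqP ef] nz]; last first.
  by apply: HC => //; apply: contraNneq nz => ->; rewrite rmorph0 mul0r.
rewrite (@mulr_fsum_r _ _ C) => [|e nz]; last first.
  have [/eqP ef se] : kill P1 e == f + eX u b%:Z /\ s e != 0; last exact: HC.
  have ef : kill P1 e == f + eX u b%:Z.
    by apply: contraNT nz => /negPf ->; rewrite /= rmorph0.
  rewrite ef; split=> //; move: nz; rewrite ef; apply: contraNneq => ->.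
  by rewrite /= rmorph0 mul0r rmorph0.
by apply: eq_fsum => e; rewrite /F; case: ifP => // _; rewrite /= rmorph0 mulr0.
Qed.

(** * Products of geometric series and extraction of one block of variables *)

Section GeometricProducts.
Variables (V : finType) (R : comPzRingType).
Implicit Types (e d f : expo V) (u v w : V) (D : {set V}) (ws : seq V).

(** This is the closed form of the product of the series [1 / (v - y v)] for [v] in [D]. *)
Definition gprod (y : V -> R) D : fseries V R := fun e =>
  if [forall v, if v \in D then e v < 0 else e v == 0]
  then \prod_(v in D) y v ^+ negexp (e v) else 0.

Lemma gprod0 y : gprod y finset.set0 = sone.
Proof.
apply/funext => e; rewrite /gprod /sone /sconst big_set0.
congr (if _ then _ else _); apply/forallP/eqP => [H|-> v]; last by rewrite inE ffunE.
by apply/ffunP => v; have := H v; rewrite inE ffunE => /eqP.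
Qed.

Lemma gprod1 y u : gprod y [set u] = sgeom u (sconst (y u)).
Proof.
apply/funext => e; rewrite sgeom_sconst /gprod big_set1.
congr (if _ then _ else _); apply/forallP/andP => [H|[e0 /eqP eE] v].
  split; first by have := H u; rewrite inE eqxx.
  apply/eqP/ffunP => v; rewrite eXE; case: eqP => [-> //|/eqP vu].
  by have := H v; rewrite inE (negPf vu) => /eqP.
by rewrite inE; case: eqP => [->//|/eqP vu]; rewrite eE eXE (negPf vu).
Qed.

(** By disjointness only one term of the convolution can be nonzero: the left factor must take
    exactly the exponents of [e] on [D]. *)
Lemma gprod_smul y D D' : [disjoint D & D'] ->
  smul (gprod y D) (gprod y D') = gprod y (D :|: D').
Proof.
move=> DD'; have nD' v : v \in D -> v \notin D' by move=> vD; rewrite (disjointFr DD').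
apply/funext => e; pose d0 : expo V := [ffun v => if v \in D then e v else 0].
have gE E d : gprod y E d != 0 -> forall v, if v \in E then d v < 0 else d v == 0.
  by rewrite /gprod; case: forallP => //; rewrite eqxx.
rewrite /smul (@fsum1 _ _ d0) => [|d]; last first.
  apply: contra_neqP => /eqP /mulr_neq0W [/gE Hd /gE Hed]; apply/ffunP => v.
  rewrite ffunE; have := Hed v; have := Hd v; rewrite expoB.
  case: (boolP (v \in D)) => [vD _|_ /eqP //].
  by rewrite (negPf (nD' v vD)) subr_eq0 => /eqP.
have -> : gprod y (D :|: D') e =
    if [forall v, if v \in D then d0 v < 0 else d0 v == 0] &&
       [forall v, if v \in D' then (e - d0) v < 0 else (e - d0) v == 0]
    then \prod_(v in D :|: D') y v ^+ negexp (e v) else 0.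
  congr (if _ then _ else _); apply/forallP/andP => [H|[/forallP H1 /forallP H2] v].
    split; apply/forallP => v; have := H v; rewrite ?expoB ffunE inE.
      by case: (v \in D) => /=.
    case: (boolP (v \in D)) => [vD _|_ /=]; last by rewrite subr0.
    by rewrite (negPf (nD' v vD)) subrr.
  have := H1 v; have := H2 v; rewrite expoB ffunE inE.
  by case: (v \in D) => /=; rewrite ?subr0.
have -> : \prod_(v in D :|: D') y v ^+ negexp (e v) =
    (\prod_(v in D) y v ^+ negexp (d0 v)) * \prod_(v in D') y v ^+ negexp ((e - d0) v).
  rewrite (bigID (fun v => v \in D)) /=; congr (_ * _).
    apply: eq_big => [v|v /andP[_ vD]]; last by rewrite ffunE vD.
    by rewrite finset.in_setU; case: (v \in D); rewrite ?andbF.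
  apply: eq_big => [v|v /andP[_ /negPf vD]]; last by rewrite expoB ffunE vD subr0.
  rewrite finset.in_setU.
  by case: (boolP (v \in D)) => [/nD' /negPf ->|_] //=; rewrite andbT.
rewrite /gprod; case: ifP => _ /=; last by rewrite mul0r.
by case: ifP => _; rewrite ?mulr0.
Qed.

Lemma gprod_sprod (I : eqType) (r : seq I) y (D : I -> {set V}) : uniq r ->
  (forall i j, i != j -> [disjoint D i & D j]) ->
  \sprod_(i <- r) gprod y (D i) = gprod y (\bigcup_(i <- r) D i).
Proof.
move=> + HD; elim: r => [|i r IHr] /=; first by rewrite !big_nil gprod0.
move=> /andP[ir ur]; rewrite !big_cons IHr // gprod_smul //.
rewrite disjoint_subset; apply/fintype.subsetP => v vDi; rewrite !inE.
elim: r ir {IHr ur} => [|j r IHr]; first by rewrite big_nil inE.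
rewrite inE negb_or big_cons finset.in_setU => /andP[ij /IHr /negPf ->].
by rewrite orbF (disjointFr (HD _ _ ij) vDi).
Qed.

Definition restr ws e : expo V := [ffun v => if v \in ws then e v else 0].

(** Each factor contributes [w ^ (- n - 1) u ^ n] with coefficient 1, so the exponents on [ws]
    determine that of [u]. *)
Lemma sprod_sgeom_svar u ws e : uniq (u :: ws) ->
  (\sprod_(w <- ws) sgeom w (svar u)) e =
  (all (fun w => e w < 0) ws &&
   (e == eX u (\sum_(w <- ws) negexp (e w))%N%:Z + restr ws e))%:R :> R.
Proof.
elim: ws e => [|w ws IHws] e /=.
  move=> _; rewrite !big_nil eX0 /sone /sconst add0r.
  rewrite (_ : restr [::] e = 0); first by case: eqP.
  by apply/ffunP => v; rewrite !ffunE.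
rewrite inE negb_or => /and3P[/andP[uw uws] wws ws_uniq].
have {}IHws d := IHws d; rewrite /= uws ws_uniq in IHws.
(* The other factors do not involve [w], so [d0] is the only monomial of the first factor that can
   contribute. *)
pose d0 := eX w (e w) + eX u (negexp (e w))%:Z.
have d0E v : v != w -> v != u -> d0 v = 0.
  by move=> vw vu; rewrite expoD !eXE (negPf vw) (negPf vu) addr0.
have d0w : d0 w = e w by rewrite expoD eXu eXE eq_sym (negPf uw) addr0.
have d0ws v : v \in ws -> (e - d0) v = e v.
  move=> vws; rewrite expoB d0E ?subr0 //; first by apply: contraNneq wws => <-.
  by apply: contraNneq uws => <-.
rewrite big_cons /smul (@fsum1 _ _ d0) => [|d dd0]; last first.
  rewrite sgeom_svar // IHws //; case: eqP => [dE|_]; last by rewrite andbF mul0r.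
  case: eqP => [edE|_]; last by rewrite andbF mulr0.
  case/negP: dd0; have ed0 : d w = e w.
    have := congr1 (fun g : expo V => g w) edE.
    rewrite expoB expoD eXE eq_sym (negPf uw) ffunE (negPf wws) => /eqP.
    by rewrite add0r subr_eq0 => /eqP.
  by rewrite {1}dE ed0.
rewrite sgeom_svar // d0w eqxx andbT IHws //.
rewrite (eq_in_all (a2 := fun v => e v < 0)) => [|v vws]; last by rewrite d0ws.
rewrite (eq_big_seq (fun v => negexp (e v))) => [|v vws]; last by rewrite d0ws.
rewrite -natrM mulnb andbA; congr (nat_of_bool (_ && _))%:R.
rewrite subr_eq big_cons PoszD eX_add.
congr (_ == _); apply/ffunP => v; rewrite !expoD ![restr _ _ _]ffunE inE.
have [->|vw] := eqVneq v w.
  by rewrite (negPf wws) !eXE eq_sym (negPf uw) eqxx !add0r addr0.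
case: ifP => [/d0ws ->|_]; rewrite !eXE (negPf vw) /=; last by rewrite !addr0 add0r addrC.
by rewrite add0r addrC addrA.
Qed.

(* A nonzero term of the convolution has the exponents of [f] on [ws], because
   [t] does not involve [ws]; it is then determined by its exponent in [u]. *)
Lemma smul_block u ws (phi : int -> R) (F t : fseries V R) f :
  uniq (u :: ws) ->
  (forall d, F d = if d == eX u (d u) then phi (d u) else 0) ->
  (forall g, t g != 0 -> 0 <= g u) ->
  (forall g w, w \in ws -> t g != 0 -> g w = 0) ->
  (forall w, w \in ws -> f w < 0) ->
  smul (smul F (\sprod_(w <- ws) sgeom w (svar u))) t f =
  \fsum_(b : nat) phi (f u - (\sum_(w <- ws) negexp (f w))%N%:Z - b%:Z) *
                  t (f - restr (u :: ws) f + eX u b%:Z).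
Proof.
move=> uws FE tu tws fws.
have /= /andP[u_ws ws_uniq] := uws.
pose m d := (\sum_(w <- ws) negexp (d w))%N%:Z.
(* [ok] describes the monomials that can occur in the first product; in such a monomial the
   geometric series supply [u ^ m d], and [F] supplies the rest of the power of [u]. *)
pose ok d := all (fun w => d w < 0) ws && (d == eX u (d u) + restr ws d).
have restr_eX d a : restr ws (d - eX u a) = restr ws d.
  apply/ffunP => v; rewrite !ffunE; case: ifP => // vws.
  by rewrite (_ : v == u = false) ?subr0 //; apply: contraNF u_ws => /eqP <-.
have eX_ws d a w : w \in ws -> (d - eX u a) w = d w.
  move=> wws; rewrite expoB eXE (_ : w == u = false) ?subr0 //.
  by apply: contraNF u_ws => /eqP <-.
have FG d : smul F (\sprod_(w <- ws) sgeom w (svar u)) d =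
    if ok d then phi (d u - m d) else 0.
  have GE a : (\sprod_(w <- ws) sgeom w (svar u)) (d - eX u a) =
      (ok d && (d u - a == m d))%:R :> R.
    rewrite sprod_sgeom_svar // restr_eX.
    rewrite (eq_in_all (a2 := fun v => d v < 0)) => [|v vws]; last by rewrite eX_ws.
    rewrite (eq_big_seq (fun v => negexp (d v))) => [|v vws]; last by rewrite eX_ws.
    rewrite -andbA; congr (nat_of_bool (_ && _))%:R; rewrite -/(m d).
    apply/eqP/andP => [E|[/eqP E /eqP E']]; last first.
      by rewrite -E' eX_sub {1}E addrAC.
    have E' : d u - a = m d.
      have := congr1 (fun g : expo V => g u) E.
      by rewrite expoB expoD !eXu ffunE (negPf u_ws) addr0.
    rewrite E' eqxx; split=> //; rewrite -E' eX_sub in E; apply/eqP.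
    by apply: (@addIr _ (- eX u a)); rewrite E addrAC.
  rewrite /smul (@fsum_inj _ _ _ (eX u)) => [|g g' /eX_inj //|g /mulr_neq0W [+ _]]; last first.
    by rewrite FE; case: ifP => [/eqP gE _|_]; [exists (g u) | rewrite eqxx].
  rewrite (eq_fsum (G := fun a => if ok d && (d u - a == m d) then phi a else 0)).
    case: (ok d) => /=; last exact: fsum_eq0.
    rewrite (@fsum1 _ _ (d u - m d)) => [|a aE]; first by rewrite subKr eqxx.
    rewrite ifF //; apply: contraNF aE => /eqP <-.
    by rewrite subKr.
  by move=> a; rewrite GE FE eXu eqxx; case: (_ && _); rewrite ?mulr1 ?mulr0.
have okE d : ok d -> t (f - d) != 0 -> d = eX u (d u) + restr ws f.
  move=> /andP[_ /eqP dE] tfd; rewrite {1}dE; congr (_ + _); apply/ffunP => v.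
  rewrite !ffunE; case: ifP => // vws.
  by have /eqP := tws _ _ vws tfd; rewrite expoB subr_eq0 => /eqP.
pose i a : expo V := eX u a + restr ws f.
have iu a : i a u = a by rewrite expoD eXu ffunE (negPf u_ws) addr0.
have i_ws a w : w \in ws -> i a w = f w.
  move=> wws; rewrite expoD eXE ffunE wws (_ : w == u = false) ?add0r //.
  by apply: contraNF u_ws => /eqP <-.
have i_ok a : ok (i a).
  rewrite /ok iu; apply/andP; split; first by apply/allP => w wws; rewrite i_ws ?fws.
  apply/eqP; rewrite {1}/i; congr (_ + _); apply/ffunP => v.
  by rewrite [LHS]ffunE [RHS]ffunE; case: ifP => // vws; rewrite i_ws.
(* The index [b] is the exponent of [u] in the monomial taken from [t], which is non-negative by
   [tu]. *)
rewrite /smul (@fsum_inj _ _ _ (fun b : nat => i (f u - b%:Z))).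
- apply: eq_fsum => b; rewrite -/(smul _ _ _) FG i_ok iu; congr (phi _ * t _).
    rewrite addrAC; congr (_ - _ - _); rewrite /m; congr (Posz _).
    by apply: eq_big_seq => w wws; rewrite i_ws.
  apply/ffunP => v; rewrite !ffunE inE; case: (v =P u) => [->|_] /=.
    by rewrite (negPf u_ws) subrr addr0 subKr add0r.
  by rewrite add0r addr0.
- move=> b b' /(congr1 (fun g : expo V => g u)); rewrite !iu.
  by move=> /addrI /oppr_inj [].
- move=> d /mulr_neq0W [+ tfd]; rewrite -/(smul _ _ _) FG.
  case: ifP => [okd _|]; last by rewrite eqxx.
  exists (absz (f u - d u)); have := tu _ tfd; rewrite expoB => H.
  by rewrite gez0_abs // subKr; apply: okE.
Qed.

End GeometricProducts.

(** * Series not involving a given variable *)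

Section VanishingExponent.
Variables (V : finType) (R : comPzRingType) (w : V).

Definition supp0 (s : fseries V R) := forall e, s e != 0 -> e w = 0.

Lemma supp0_sone : supp0 sone.
Proof. by move=> e /sone_neq0 ->; rewrite ffunE. Qed.

Lemma supp0_smul s t : supp0 s -> supp0 t -> supp0 (smul s t).
Proof.
move=> Hs Ht e /smul_neq0 [d [/Hs dw /Ht]].
by rewrite expoB dw subr0.
Qed.

Lemma supp0_sprod (I : eqType) (r : seq I) (F : I -> fseries V R) :
  (forall i, i \in r -> supp0 (F i)) -> supp0 (\sprod_(i <- r) F i).
Proof.
move=> HF; rewrite big_seq; elim/big_rec: _ => [|i s ri Hs]; first exact: supp0_sone.
by apply: supp0_smul => //; apply: HF.
Qed.

End VanishingExponent.

(** * The blocks of variables and the factors of the right-hand side *)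

Section BlockVariables.
Variables (k : nat) (A : 'I_k -> finType).
Local Notation V := (vars k A).
Implicit Types (e : expo V) (v : V) (i : 'I_k) (j : nat).

Definition vidx v : 'I_k := match v with inl l => l | inr x => tag x end.

Definition vrank v : nat := match v with inl l => l | inr _ => k end.

Definition lower_u j v : bool := if v is inl l then (l < j)%N else false.

Definition avars i : seq V := map (@avar k A i) (index_enum (A i)).

(** Unlike [kill (lower_u j)], this also removes the elements of the [A_i] with [i < j]: these
    variables are extracted along with their block, not substituted. *)
Definition kill_blocks j e : expo V :=
  [ffun v => if (vidx v < j)%N then 0 else e v].

Lemma mem_block i v : (v \in uvar A i :: avars i) = (vidx v == i).
Proof.
rewrite inE; apply/idP/eqP => [/orP[/eqP -> //|/mapP[a _ ->] //]|].
case: v => [l /= ->|[l a] /= li]; first by rewrite eqxx.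
by subst l; apply/mapP; exists a; rewrite ?mem_index_enum.
Qed.

Lemma avar_inj i : injective (@avar k A i).
Proof. by move=> a b [] /eqP; rewrite eq_Tagged => /eqP. Qed.

Lemma uniq_block i : uniq (uvar A i :: avars i).
Proof.
rewrite /= map_inj_uniq ?index_enum_uniq ?andbT; last exact: avar_inj.
by apply/mapP => - [].
Qed.

Lemma kill_blocksS i e :
  kill_blocks i e - restr (uvar A i :: avars i) (kill_blocks i e) =
  kill_blocks i.+1 e.
Proof.
apply/ffunP => v; rewrite expoB [restr _ _ v]ffunE mem_block !ffunE ltnS.
rewrite (leq_eqVlt (vidx v)) (inj_eq val_inj).
by case: (vidx v =P i) => [->|_] /=; rewrite ?ltnn ?subrr ?subr0.
Qed.

Section Factors.
Variables (R : comPzRingType) (q : forall i : nat, {ffun 'I_i -> int} -> int -> R).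
Variable M : forall i : nat, {fset {ffun 'I_i -> int}}.

Definition shift_arg i (m : {ffun 'I_i -> int}) : fseries V R := fun e =>
  \sum_(j < i) svar (uvar A (widen_ord (ltnW (ltn_ord i)) j)) e *~ m j.

Definition Qfactor i : fseries V R :=
  \sprod_(m <- M i) sshift (q m) (uvar A i) (shift_arg m).

Definition geom_factor i : fseries V R :=
  \sprod_(w <- avars i) sgeom w (svar (uvar A i)).

Lemma shift_arg_neq0 i (m : {ffun 'I_i -> int}) e : shift_arg m e != 0 ->
  exists2 j : 'I_k, (j < i)%N & e = eX (uvar A j) 1.
Proof.
rewrite /shift_arg => nz.
have /existsP [j jnz] : [exists j : 'I_i,
    svar (uvar A (widen_ord (ltnW (ltn_ord i)) j)) e != 0 :> R].
  apply: contraNT nz => /existsPn H; apply/eqP/big1 => j _.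
  by have := H j; rewrite negbK => /eqP ->; rewrite mul0rz.
exists (widen_ord (ltnW (ltn_ord i)) j); first exact: (ltn_ord j).
by apply/eqP; apply: contraNT jnz => /negPf ne; rewrite /svar svarXE ne.
Qed.

Lemma shift_arg_supp0 i (m : {ffun 'I_i -> int}) v :
  ~~ lower_u i v -> supp0 v (shift_arg m).
Proof.
move=> iv e /shift_arg_neq0 [j ji ->]; rewrite eXE.
by case: eqP => // vj; rewrite vj /= ji in iv.
Qed.

Lemma shift_arg_usum i (m : {ffun 'I_i -> int}) e : shift_arg m e != 0 ->
  forall v, usum vrank v e <= (vrank v < vrank (uvar A i))%N%:R.
Proof.
case/shift_arg_neq0 => j ji -> v; rewrite usum_eX /=.
case: ifP => // /orP[/eqP ->|vj] /=; first by rewrite ji.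
by rewrite (ltn_trans vj ji).
Qed.

Lemma ubounded_shift_arg i (m : {ffun 'I_i -> int}) : ubounded vrank (shift_arg m).
Proof.
by exists 1 => e /shift_arg_usum H v; apply: (le_trans (H v)); case: (_ < _)%N.
Qed.

Lemma nonneg_shift_arg P i (m : {ffun 'I_i -> int}) : nonneg_on P (shift_arg m).
Proof. by move=> e v /shift_arg_neq0 [j _ ->] _; rewrite eXE; case: ifP. Qed.

Lemma lower_uu i j : (j <= i)%N -> ~~ lower_u j (uvar A i).
Proof. by rewrite /= -leqNgt. Qed.

Lemma ubounded_Qfactor i : (forall m, m \in M i -> laurent (q m)) ->
  ubounded vrank (Qfactor i).
Proof.
move=> qL; apply: ubounded_sprod => m mM; apply: ubounded_sshift; first exact: qL.
  exact: (shift_arg_supp0 (lower_uu (leqnn i))).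
exact: shift_arg_usum.
Qed.

Lemma nonneg_Qfactor i j : (j <= i)%N -> nonneg_on (lower_u j) (Qfactor i).
Proof.
move=> ji; apply: nonneg_sprod => m _; apply: nonneg_sshift.
- exact: (shift_arg_supp0 (lower_uu (leqnn i))).
- exact: lower_uu.
- exact: nonneg_shift_arg.
Qed.

Lemma supp0_Qfactor i x : supp0 (inr x : V) (Qfactor i).
Proof.
apply: supp0_sprod => m _; apply: sshift_supp0 => //.
  exact: (shift_arg_supp0 (lower_uu (leqnn i))).
exact: shift_arg_supp0.
Qed.

Lemma ubounded_geom_factor i : ubounded vrank (geom_factor i).
Proof.
apply: ubounded_sprod => w /mapP[a _ ->]; apply: ubounded_sgeom_svar; exact: ltn_ord.
Qed.

Lemma nonneg_geom_factor i j : nonneg_on (lower_u j) (geom_factor i).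
Proof. by apply: nonneg_sprod => w /mapP[a _ ->]; apply: nonneg_sgeom_svar. Qed.

Lemma supp0_geom_factor i v : vidx v != i -> supp0 v (geom_factor i).
Proof.
rewrite -mem_block inE negb_or => /andP[vu vws] e.
rewrite /geom_factor sprod_sgeom_svar ?uniq_block //.
case: (boolP (_ && _)) => [/andP[_ /eqP ->] _|_]; last by rewrite eqxx.
by rewrite expoD eXE ffunE (negPf vu) (negPf vws).
Qed.

End Factors.
End BlockVariables.

(** * Induction along the tower of maps *)

Section Tower.
Variables (C : chow_theory) (k : nat).
Variables (X : nat -> variety C) (p : forall i : nat, mor (X i.+1) (X i)).
Hypothesis p_proper : forall i : nat, (i < k)%N -> proper_map (p i).
Variable c : forall i : nat, chow (X i.+1).
Variable M : forall i : nat, {fset {ffun 'I_i -> int}}.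
Variable Q : forall i : nat, {ffun 'I_i -> int} -> int -> chow (X 0%N).
Hypothesis Q_laurent : forall (i : nat) (m : {ffun 'I_i -> int}),
  (i < k)%N -> m \in M i -> laurent (Q m).
Hypothesis push_geom : forall i : nat, (i < k)%N ->
  spush (p i) (sgeom tt (sconst (c i))) =1
  \sprod_(m <- M i)
     sshift (fun a => pull (tower_map p i) (Q m a)) tt
       (fun e => \sum_(j < i) sconst (tower_class p c i j) e *~ m j).
Variable A : 'I_k -> finType.
Local Notation V := (vars k A).
Local Notation vrk := (@vrank k A).
Implicit Types (e : expo V) (v : V) (i : 'I_k) (j : nat).

(** The elements of [A_i] carry the same class as [u_i], so that a single product over variables
    collects all the extracted powers of the [c_i]. *)
Definition tclass j v : chow (X j) := tower_class p c j (vidx v).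

(** Substitution of [c_l] for [u_l], for all [l < j]. *)
Definition eval_at j : fseries V (chow (X 0%N)) -> fseries V (chow (X j)) :=
  spec (pull (tower_map p j)) (lower_u j) (tclass j).

Definition tower_factor i : fseries V (chow (X 0%N)) :=
  smul (Qfactor Q M i) (geom_factor (chow (X 0%N)) i).

(** Extension by 1 beyond [k], which allows the tails to be indexed by natural numbers. *)
Definition tower_factor_nat n := oapp tower_factor sone (insub n).

Definition tower_tail j : fseries V (chow (X 0%N)) :=
  \big[@smul _ _/sone]_(j <= n < k) tower_factor_nat n.

Lemma tower_tailE i : tower_tail i = smul (tower_factor i) (tower_tail i.+1).
Proof. by rewrite /tower_tail big_ltn // /tower_factor_nat valK. Qed.

Lemma tower_tail_rect (K : fseries V (chow (X 0%N)) -> Prop) j :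
  K sone -> (forall s t, K s -> K t -> K (smul s t)) ->
  (forall i, (j <= i)%N -> K (tower_factor i)) -> K (tower_tail j).
Proof.
move=> K1 KM KF; rewrite /tower_tail big_seq; elim/big_rec: _ => // n s nk Ks.
apply: KM => //; rewrite /tower_factor_nat; case: insubP => //= i _ ni.
by apply: KF; move: nk; rewrite mem_index_iota -ni => /andP[].
Qed.

Lemma ubounded_factor i : ubounded vrk (tower_factor i).
Proof.
apply: ubounded_smul; last exact: ubounded_geom_factor.
apply: ubounded_Qfactor => m.
exact/Q_laurent/ltn_ord.
Qed.

Lemma ubounded_tail j : ubounded vrk (tower_tail j).
Proof.
apply: tower_tail_rect; [exact: ubounded_sone | exact: ubounded_smul |].
by move=> i _; exact: ubounded_factor.
Qed.

(** In a factor of index at least [j], the [u_l] with [l < j] occur only in the arguments of the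
    shifts, which are expanded in non-negative powers. This makes their substitution meaningful. *)
Lemma nonneg_tail j : nonneg_on (lower_u j) (tower_tail j).
Proof.
apply: tower_tail_rect => [||i ji]; [exact: nonneg_sone | exact: nonneg_smul |].
apply: nonneg_smul; [exact: nonneg_Qfactor | exact: nonneg_geom_factor].
Qed.

Lemma supp0_tail j (x : {i : 'I_k & A i}) :
  (tag x < j)%N -> supp0 (inr x : V) (tower_tail j).
Proof.
move=> xj; apply: tower_tail_rect => [||i ji].
- exact: supp0_sone.
- exact: supp0_smul.
apply: supp0_smul; first exact: supp0_Qfactor.
apply: supp0_geom_factor; apply: contraTneq ji => <-.
by rewrite -ltnNge.
Qed.

(** The hypothesis on the push-forward along [p i] enters here: substituting the classes for the
    lower variables produces its right-hand side, in the variable [u_i]. *)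
Lemma eval_Qfactor i :
  eval_at i (Qfactor Q M i) =
  emb (uvar A i) (spush (p i) (sgeom tt (sconst (c i)))).
Proof.
have uu := lower_uu A (leqnn i).
rewrite (funext (push_geom (ltn_ord i))) emb_sprod /eval_at.
rewrite (spec_sprod (rk := @vrank k A)); first last.
- move=> m mM; apply: nonneg_sshift => //; last exact: nonneg_shift_arg.
  exact: shift_arg_supp0.
- move=> m mM; apply: ubounded_sshift; first exact/Q_laurent/mM/ltn_ord.
    exact: shift_arg_supp0.
  exact: shift_arg_usum.
rewrite big_seq [RHS]big_seq; apply: eq_bigr => m mM.
pose b := \sum_(j < i) tower_class p c i j *~ m j.
have -> : (fun g => \sum_(j < i) sconst (tower_class p c i j) g *~ m j) =
    sconst b :> fseries unit _.
  apply/funext => g; rewrite /sconst; case: eqP => // _.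
  by rewrite big1 // => j _; rewrite mul0rz.
rewrite emb_sshift (spec_sshift (rk := @vrank k A) (b := b)) //.
- exact/Q_laurent/mM/ltn_ord.
- exact: shift_arg_supp0.
- exact: ubounded_shift_arg.
- exact: nonneg_shift_arg.
- rewrite spec_sum_svar // => j; exact: (ltn_ord j).
Qed.

(** None of the substituted variables occurs, and the coefficients, being 0 or 1, are preserved by
    pull-back. *)
Lemma eval_geom_factor i :
  eval_at i (geom_factor (chow (X 0%N)) i) = geom_factor (chow (X i)) i.
Proof.
rewrite /eval_at spec_off => [|e [l|//] /= nz li].
  apply/funext => e; rewrite /geom_factor !sprod_sgeom_svar ?uniq_block //.
  by rewrite rmorph_nat.
apply: (supp0_geom_factor (i := i)) nz => /=.
by apply: contraTneq li => ->; rewrite ltnn.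
Qed.

(** This is the exponent [N_i] of [c_i] on the left-hand side. *)
Definition block_exp i e : nat := (\sum_(v | vidx v == i) negexp (e v))%N.

Lemma block_expE i e : block_exp i e =
  (negexp (e (uvar A i)) + \sum_(w <- avars A i) negexp (e w))%N.
Proof.
transitivity (\sum_(v <- uvar A i :: avars A i) negexp (e v))%N;
  last by rewrite big_cons.
by rewrite big_uniq ?uniq_block //; apply: eq_bigl => v; rewrite mem_block.
Qed.

(** Extracting the block [i] gives a sum over [b] of the push-forwards of [c_i ^ (N_i + b)] times
    the coefficients of [u_i ^ b] in the substituted tail. By the projection formula these
    coefficients move inside the push-forward, where the sum over [b] amounts to substituting [c_i]
    for [u_i]. *)
Lemma eval_tail_step i e : (forall v, e v < 0) ->
  eval_at i (tower_tail i) (kill_blocks i e) =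
  push (p i) (c i ^+ block_exp i e *
    eval_at i.+1 (tower_tail i.+1) (kill_blocks i.+1 e)).
Proof.
move=> e0; set f := kill_blocks i e; set u := uvar A i.
have fE v : vidx v == i -> f v = e v by move=> /eqP vi; rewrite ffunE vi ltnn.
have nn : nonneg_on (lower_u i) (tower_tail i.+1).
  move=> d [l|//] /= nz li; apply: (nonneg_tail nz) => /=.
  exact: ltn_trans li _.
rewrite tower_tailE /eval_at (spec_smul (rk := @vrank k A)) //; first last.
- apply: nonneg_smul; [exact: nonneg_Qfactor | exact: nonneg_geom_factor].
- exact: ubounded_tail.
- exact: ubounded_factor.
rewrite /tower_factor (spec_smul (rk := @vrank k A)); first last.
- exact: nonneg_geom_factor.
- exact: nonneg_Qfactor.
- exact: ubounded_geom_factor.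
- by apply: ubounded_Qfactor => m; apply/Q_laurent/ltn_ord.
rewrite -/(eval_at i) eval_Qfactor eval_geom_factor.
(* [phi a] is the coefficient of [u ^ a] in the push-forward of [1 / (u - c_i)]. *)
pose phi (a : int) := if a < 0 then push (p i) (c i ^+ negexp a) else 0.
have t0 g : eval_at i (tower_tail i.+1) g != 0 -> exists2 d, kill (lower_u i) d = g &
    tower_tail i.+1 d != 0.
  by move/spec_neq0 => [d [dg nz]]; exists d.
rewrite (smul_block (phi := phi)); first last.
- move=> w /mapP[a _ ->]; rewrite fE //; exact: e0.
- move=> g w /mapP[a _ ->] /t0 [d <- nz]; rewrite killE /=.
  by apply: (supp0_tail (j := i.+1)) nz => /=; apply: ltnSn.
- move=> g /t0 [d <- nz]; rewrite killE (negPf (lower_uu A (leqnn i))).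
  by apply: (nonneg_tail nz) => /=; apply: ltnSn.
- move=> d; rewrite /emb /spush sgeom_sconst eXu eqxx andbT; case: eqP => // _.
  by rewrite /phi; case: ifP; rewrite ?raddf0.
- exact: uniq_block.
rewrite kill_blocksS.
(* The new substitution on [X_(i+1)] is the one on [X_i], pulled back along [p i], followed by that
   of [c_i] for [u_i]. *)
have [|||||||B [tB ->]] := @spec_step _ vrk _ _ _ (pull (tower_map p i))
  (pull (tower_map p i.+1)) (pull (p i)) (lower_u i) (lower_u i.+1)
  (tclass i) (tclass i.+1) u (tower_tail i.+1) (kill_blocks i.+1 e).
- by move=> a; rewrite /= pull_comp.
- exact: lower_uu.
- by move=> [l|x] //=; rewrite ltnS leq_eqVlt.
- move=> [l /= li|//]; rewrite /tclass /=; case: eqP => // li'.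
  by rewrite li' ltnn in li.
- exact: ubounded_tail.
- exact: nonneg_tail.
- by rewrite ffunE /= ltnSn.
rewrite -/(eval_at i) in tB *.
rewrite (@fsumE _ _ B) => [|b]; last first.
  by apply: contraR => /tB; rewrite -/(eval_at i) => ->; rewrite mulr0.
rewrite mulr_sumr [RHS]raddf_sum.
apply: eq_bigr => b _.
rewrite /tclass /= eqxx mulrA -exprD mulrC.
rewrite [in RHS]mulrC projection_formula; last exact: p_proper.
congr (_ * _).
(* The exponent [- n - 1] corresponds to the power [n] of [c_i], so the powers from [u_i], from
   [A_i] and from the tail add up to [N_i + b]. *)
have -> : f u - (\sum_(w <- avars A i) negexp (f w))%N%:Z - b%:Z =
    - (block_exp i e + b)%N%:Z - 1.
  rewrite block_expE fE // (eq_big_seq (fun w => negexp (e w))) => [|w wA].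
    rewrite {1}(negexpE (e0 u)) -/u; move: (negexp _) (\sum_(w <- _) _)%N => n1 n2.
    by lia.
  by rewrite fE // -mem_block inE wA orbT.
rewrite /phi ifT; last by lia.
by congr (push _ (_ ^+ _)); rewrite /negexp; lia.
Qed.

Lemma proper_tower j : (j <= k)%N -> proper_map (tower_map p j).
Proof.
elim: j => [|j IHj] jk; first exact: proper_id.
by apply: proper_comp; [apply: IHj; exact: ltnW | exact: p_proper].
Qed.

(** The invariant of the induction: the first [j] blocks have been turned into powers of classes on
    [X_j], and the remaining ones still have to be extracted from the substituted tail. *)
Lemma tower_tail0_push e j : (forall v, e v < 0) -> (j <= k)%N ->
  tower_tail 0 e = push (tower_map p j)
    ((\prod_(v : V | (vidx v < j)%N) tclass j v ^+ negexp (e v)) *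
     eval_at j (tower_tail j) (kill_blocks j e)).
Proof.
move=> e0; elim: j => [|j IHj] jk.
  rewrite push_id big_pred0 // mul1r /eval_at spec_off; last by move=> ? [].
  rewrite /= pull_id; congr tower_tail; apply/ffunP => v.
  by rewrite ffunE.
have j_proper := proper_tower (ltnW jk); have pj_proper := p_proper jk.
rewrite (IHj (ltnW jk)) push_comp //; pose i := Ordinal jk.
(* The projection formula pulls the powers already collected back to the next level of the tower. *)
rewrite (eval_tail_step i e0) -projection_formula //.
congr (push _ (push _ _)); rewrite mulrA; congr (_ * _).
(* The block [i] of the new product is [c_i ^ N_i]; the other blocks are the pull-back of the old
   product. *)
rewrite [RHS](bigID (fun v => vidx v == i)) /= mulrC; congr (_ * _).
  rewrite /block_exp -prodrXr; apply: eq_big => [v|v /eqP vi].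
    by case: eqP => [->|_]; rewrite ?ltnSn ?andbF.
  by rewrite /tclass vi /= eqxx.
rewrite rmorph_prod; apply: eq_big => [v|v vj].
  by rewrite ltnS [in RHS]leq_eqVlt -(inj_eq val_inj) /=; case: (ltngtP (vidx v) j).
by rewrite rmorphXn /tclass /=; case: eqP => // vj'; rewrite vj' ltnn in vj.
Qed.

End Tower.

(** * The left-hand side in closed form, and the conclusion *)

Lemma sprod_sgeom_sconst (R : comPzRingType) (k : nat) (A : 'I_k -> finType)
    (b : 'I_k -> R) :
  \sprod_(i < k)
     smul (sgeom (uvar A i) (sconst (b i)))
          (\sprod_(a : A i) sgeom (avar a) (sconst (b i))) =
  gprod (fun v : vars k A => b (vidx v)) [set: vars k A].
Proof.
pose y (v : vars k A) := b (vidx v).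
(* The blocks partition the set of all variables, so [gprod_sprod] assembles the whole product from
   them. *)
pose block i : {set vars k A} := [set v | vidx v == i].
have blockE i : block i = [set uvar A i] :|: \bigcup_(a : A i) [set avar a].
  apply/setP => v; rewrite !inE -mem_block in_cons; congr (_ || _).
  apply/mapP/bigcupP => - [a].
    by move=> _ ->; exists a; rewrite ?inE.
  by rewrite inE => _ /eqP ->; exists a; rewrite ?mem_index_enum.
rewrite (eq_bigr (fun i => gprod y (block i))) => [|i _].
  rewrite gprod_sprod ?index_enum_uniq // => [|i j ij].
    congr gprod; apply/setP => v; rewrite inE; apply/bigcupP.
    by exists (vidx v); rewrite ?inE.
  rewrite disjoint_subset; apply/fintype.subsetP => v; rewrite !inE => /eqP ->.
  exact: ij.
rewrite blockE -gprod_smul.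
  rewrite -gprod_sprod ?index_enum_uniq // => [|a a' aa'].
    by rewrite gprod1; congr smul; apply: eq_bigr => a _; rewrite gprod1.
  rewrite disjoint_subset; apply/fintype.subsetP => v; rewrite !inE => /eqP ->.
  by apply: contraNneq aa' => /avar_inj ->.
rewrite disjoint_subset; apply/fintype.subsetP => v; rewrite !inE => /eqP ->.
by apply/bigcupP => - [a _]; rewrite inE.
Qed.

Theorem theorem2p3 (C : chow_theory) (k : nat) (k_gt0 : (0 < k)%N)
  (X : nat -> variety C) (p : forall i : nat, mor (X i.+1) (X i))
  (p_proper : forall i : nat, (i < k)%N -> proper_map (p i))
  (c : forall i : nat, chow (X i.+1))
  (M : forall i : nat, {fset {ffun 'I_i -> int}})
  (Q : forall i : nat, {ffun 'I_i -> int} -> int -> chow (X 0%N))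
  (Q_laurent : forall (i : nat) (m : {ffun 'I_i -> int}),
     (i < k)%N -> m \in M i -> laurent (Q i m))
  (push_geom : forall i : nat, (i < k)%N ->
     spush (p i) (sgeom tt (sconst (c i))) =1
     \sprod_(m <- M i)
        sshift (fun a => pull (tower_map p i) (Q i m a)) tt
          (fun e => \sum_(j < i) sconst (tower_class p c i j) e *~ m j))
  (A : 'I_k -> finType) :
  spush (tower_map p k)
    (\sprod_(i < k)
       smul (sgeom (uvar A i) (sconst (tower_class p c k i)))
            (\sprod_(a : A i)
               sgeom (avar a) (sconst (tower_class p c k i))))
  =1
  sneg
    (\sprod_(i < k)
       smul (\sprod_(m <- M i)
               sshift (Q i m) (uvar A i)
                 (fun e => \sum_(j < i)
                    svar (uvar A (widen_ord (ltnW (ltn_ord i)) j)) e *~ m j))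
            (\sprod_(a : A i) sgeom (avar a) (svar (uvar A i)))).
Proof.
move=> e; rewrite /spush (sprod_sgeom_sconst A (fun i => tower_class p c k i)).
have <- : tower_tail (A := A) M Q 0 =
    \sprod_(i < k)
       smul (\sprod_(m <- M i)
               sshift (Q i m) (uvar A i)
                 (fun e => \sum_(j < i)
                    svar (uvar A (widen_ord (ltnW (ltn_ord i)) j)) e *~ m j))
            (\sprod_(a : A i) sgeom (avar a) (svar (uvar A i))).
  rewrite /tower_tail big_mkord; apply: eq_bigr => i _.
  by rewrite /tower_factor_nat valK /= /tower_factor /geom_factor /avars big_map.
(* The closed form on the left vanishes unless all exponents are negative, exactly as [sneg] does on
   the right. *)
rewrite /gprod /sneg (eq_forallb (P2 := fun v => e v < 0)) => [|v]; last by rewrite inE.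
case: forallP => [e0|_]; last exact: raddf0.
(* For [j = k] all blocks have been extracted and the remaining tail is the empty product. *)
rewrite (tower_tail0_push p_proper Q_laurent push_geom e0 (leqnn k)).
rewrite /tower_tail big_geq // /eval_at spec_sone.
rewrite (_ : kill_blocks k e = 0); last first.
  by apply/ffunP => v; rewrite !ffunE ltn_ord.
rewrite /sone /sconst eqxx mulr1; congr (push _ _).
by apply: eq_bigl => v; rewrite inE ltn_ord.
Qed.
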